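(* Let $r$ be a nonconstant symmetric rational function, $Q\in\mathcal N_\kappa^{\widetilde\kappa}(r)$, $Q\ne0$, and let the canonical factorizations of $Q$ and $rQ$ be written as $$Q=\varphi\varphi^\sharp Q_0,\qquad rQ=\widetilde\varphi\,\widetilde\varphi^\sharp\,\widetilde Q_0,\qquad \varphi^\sharp(\lambda)=\overline{\varphi(\bar\lambda)},\quad \widetilde\varphi^\sharp(\lambda)=\overline{\widetilde\varphi(\bar\lambda)},$$ with $Q_0,\widetilde Q_0\in\mathcal N$ and $\varphi,\widetilde\varphi$ rational, so that $\widetilde Q_0=\widetilde rQ_0$ with $\widetilde r=\frac{r\varphi\varphi^\sharp}{\widetilde\varphi\widetilde\varphi^\sharp}$ and $Q_0\in\mathcal N_0^0(\widetilde r)$. Let $Q_0$ and $\widetilde Q_0$ be realized, with one and the same selfadjoint relation $A$ in a Hilbert space $\{\mathfrak H,(\cdot,\cdot)\}$, by the models associated with $A$, $\omega\in\mathfrak H_{-1}(A,b)$ and with $A$, $\widetilde\omega\in\mathfrak H_{-1}(A,a)$, respectively, for some $a,b\in\mathbb R\cup\{\infty\}$, and denote the corresponding $\gamma$-fields by $\gamma_\lambda^0$ and $\widetilde\gamma_\lambda^0$. Let $$\Phi(\lambda)=\begin{pmatrix}0&\varphi(\lambda)\\ \varphi^\sharp(\lambda)&0\end{pmatrix},\qquad \widetilde\Phi(\lambda)=\begin{pmatrix}0&\widetilde\varphi(\lambda)\\ \widetilde\varphi^\sharp(\lambda)&0\end{pmatrix}$$ be realized via pairs $\{A_\Phi,\gamma_\lambda^\Phi\}$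 and $\{A_{\widetilde\Phi},\widetilde\gamma_\lambda^{\widetilde\Phi}\}$ in the reproducing kernel Pontryagin spaces $\mathfrak H_\Phi$ and $\mathfrak H_{\widetilde\Phi}$. Then the functions $Q$ and $\widetilde Q=rQ$ can be realized in the Pontryagin spaces $\mathfrak H\oplus\mathfrak H_\Phi$ and $\mathfrak H\oplus\mathfrak H_{\widetilde\Phi}$ via pairs $\{A_0,\gamma_\lambda\}$ and $\{\widetilde A_0,\widetilde\gamma_\lambda\}$, respectively, where $$\gamma_\lambda=\begin{pmatrix}\gamma_\lambda^0\,\varphi(\lambda)\\ \gamma_\lambda^\Phi\begin{pmatrix}Q_0(\lambda)\varphi(\lambda)\\1\end{pmatrix}\end{pmatrix},\qquad \widetilde\gamma_\lambda=\begin{pmatrix}\widetilde\gamma_\lambda^0\,\widetilde\varphi(\lambda)\\ \widetilde\gamma_\lambda^{\widetilde\Phi}\begin{pmatrix}\widetilde Q_0(\lambda)\widetilde\varphi(\lambda)\\1\end{pmatrix}\end{pmatrix},$$ and where $A_0$ and $\widetilde A_0$ are selfadjoint extensions of $S_0\oplus S_\Phi$ and $\widetilde S_0\oplus\widetilde S_{\widetilde\Phi}$ satisfying $\gamma_\lambda=(I+(\lambda-\mu)(A_0-\lambda)^{-1})\gamma_\mu$ and $\widetilde\gamma_\lambda=(I+(\lambda-\mu)(\widetilde A_0-\lambda)^{-1})\widetilde\gamma_\mu$, respectively.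
   Context: Function classes. A function is symmetric if $f(\bar z)=\overline{f(z)}$. $\mathcal N=\mathcal N_0$: symmetric functions holomorphic on $\mathbb C\setminus\mathbb R$ with $\operatorname{Im}Q(z)/\operatorname{Im}z\ge0$. $\mathcal N_\kappa$: symmetric functions meromorphic on $\mathbb C\setminus\mathbb R$ whose kernel $(Q(z)-\overline{Q(w)})/(z-\bar w)$ has $\kappa$ negative squares (for matrix functions: $Q(\bar z)=Q(z)^*$ and kernel $(Q(z)-Q(w)^* )/(z-\bar w)$). $\mathcal N_\kappa^{\widetilde\kappa}(r)=\{Q\in\mathcal N_\kappa:rQ\in\mathcal N_{\widetilde\kappa}\}$. Each nonzero $Q\in\mathcal N_\kappa$ has a unique canonical factorization $Q=\phi Q_0$, $Q_0\in\mathcal N$, $\phi(z)=\frac{\prod_{i}(z-\alpha_i)^{\pi_{\alpha_i}}(z-\bar\alpha_i)^{\pi_{\alpha_i}}}{\prod_{i}(z-\beta_i)^{\kappa_{\beta_i}}(z-\bar\beta_i)^{\kappa_{\beta_i}}}$, where $\alpha_i$ (resp. $\beta_i$) are the zeros (poles) of $Q$ in $\mathbb C_+$ with their orders and the points of $\mathbb R$ with $\pi_{\alpha}>0$ (resp. $\kappa_\beta>0$); for real $\alpha,\beta$, $\pi_\alpha$ is the largest nonnegative integer with $-\infty<\lim_{z\widehat\to\alpha}Q(z)(z-\alpha)^{-(2\pi_\alpha-1)}\le0$ and $\kappa_\beta$ the smallest with $-\infty<\lim_{z\widehat\to\beta}(z-\beta)^{2\kappa_\beta+1}Q(z)\le0$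 (nontangential limits). Thus $\varphi(z)=\prod(z-\alpha_i)^{\pi_{\alpha_i}}/\prod(z-\beta_i)^{\kappa_{\beta_i}}$ gives $\phi=\varphi\varphi^\sharp$; $\Phi\in\mathcal N_\kappa$ with $\kappa=\deg\varphi$, and $\widetilde\Phi\in\mathcal N_{\widetilde\kappa}$ with $\widetilde\kappa=\deg\widetilde\varphi$. Pair realizations. A (scalar or $2\times2$ matrix) function $F$ is realized via a pair $\{B,\gamma_\lambda\}$ in a Hilbert or Pontryagin space if $B$ is a selfadjoint relation there with $\rho(B)\ne\emptyset$, $\gamma_\lambda$ is a vector function (operator function from $\mathbb C^2$ in the matrix case) with $\gamma_\lambda=(I+(\lambda-\mu)(B-\lambda)^{-1})\gamma_\mu$, and $F(\lambda)-F(\mu)^*=(\lambda-\bar\mu)\gamma_\mu^*\gamma_\lambda$ for $\lambda,\mu\in\rho(B)$ at which the expressions are defined. The associated symmetric relation is $S=\{\{f,f'\}\in B:\ (f'-\bar\lambda f,\gamma_\lambda h)=0\ \text{for all } h\}$, $\lambda\in\rho(B)$. $S_0,\widetilde S_0\subset A$, $S_\Phi\subset A_\Phi$, $\widetilde S_{\widetilde\Phi}\subset A_{\widetilde\Phi}$ are the symmetric relations associated in this way with $\{A,\gamma^0_\lambda\}$, $\{A,\widetilde\gamma_\lambda^0\}$, $\{A_\Phi,\gamma^\Phi_\lambda\}$, $\{A_{\widetilde\Phi},\widetilde\gamma^{\widetilde\Phi}_\lambda\}$. Models. A linear relation $A$ in $\mathfrak H$ is a subspace of $\mathfrak H\times\mathfrak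 H$, selfadjoint if $A=A^*$; then $A=A_o\oplus(\{0\}\times\operatorname{mul}A)$ with $A_o$ a selfadjoint operator in $\mathfrak H\ominus\operatorname{mul}A$; $P_\infty$ is the orthogonal projection onto $\mathfrak H\ominus\operatorname{mul}A$. $\mathfrak H_{+1}(A,\infty)=\operatorname{dom}|A_o|^{1/2}\oplus\operatorname{mul}A$ with inner product $(f,g)+(|A_o|^{1/2}P_\infty f,|A_o|^{1/2}P_\infty g)$; $\mathfrak H_{-1}(A,\infty)$ is the completion of $\mathfrak H$ with respect to $((I-P_\infty)f,g)+((I+|A_o|)^{-1}P_\infty f,P_\infty g)$; $\mathfrak H_{\pm1}(A,\xi)=\mathfrak H_{\pm1}((A-\xi)^{-1},\infty)$ for $\xi\in\mathbb R$; $(\cdot,\cdot)_\xi$ is the duality extending $(\cdot,\cdot)$ continuously. $A_\infty$, and $(A-\xi)^{-1}_\xi$ for $\xi\in\mathbb R$, are the closures of $A$ and $(A-\xi)^{-1}$ as relations from $\mathfrak H_{+1}(A,\xi)$ to $\mathfrak H_{-1}(A,\xi)$ ($\xi=\infty$, resp. $\xi\in\mathbb R$). The model associated with $A$ and $\omega\in\mathfrak H_{-1}(A,\xi)$ has $\gamma$-field $\gamma_\lambda^\omega=(A_\infty-\lambda)^{-1}\omega$ and Weyl function $\eta+(\gamma_\lambda^\omega,\omega)_\infty$ if $\xi=\infty$, and $\gamma_\lambda^\omega=(I+(\xi-\lambda)(A-\xi)^{-1}_\xi)^{-1}\omega$ and Weyl function $\eta+(\lambda-\xi)(\gamma_\lambda^\omega,\omega)_\xi$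 if $\xi\in\mathbb R$ ($\eta\in\mathbb R$ a constant, $\lambda\in\rho(A)$); it realizes a function if that function equals the Weyl function. *)

(* Defs.v *)
From HB Require Import structures.
From mathcomp Require Import all_boot all_order all_algebra.
From mathcomp Require Import all_classical all_reals.
From mathcomp Require Import topology normedtype derive.
From mathcomp Require Import complex.
Export numFieldNormedType.Exports.
Import Order.TTheory GRing.Theory Num.Theory Num.Def.

Set Implicit Arguments.
Unset Strict Implicit.
Unset Printing Implicit Defensive.

Local Open Scope classical_set_scope.
Local Open Scope complex_scope.
Local Open Scope ring_scope.

(* R[i] packed as a numClosedFieldType, so that it carries the topology that
   mathcomp-analysis puts on numeric fields; in the order of R[i], [0 < x] and
   [x <= y] say in particular that [x], resp. [y - x], is real. *)
Definition cplx (R : realType) : numClosedFieldType := R[i].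

Section Functions.
Variable R : realType.
Local Notation C := (cplx R).
Implicit Types (f Q : C -> C) (z : C).

Definition nonreal : set C := [set z | 'Im z != 0].

Definition hol f z := \forall w \near z, derivable f w 1.

Definition pole f z :=
  (\forall w \near z^', derivable f w 1) /\
  (forall M : R, \forall w \near z^', (M%:C : C) < `|f w|).

(* Functions are total in Rocq: a function meromorphic in C \ R is one for which
   every nonreal point is a point of holomorphy or a pole; removable
   singularities are removed, the value at a pole is meaningless, and [hol f] is
   the domain on which [f] is defined.  Real points at which [f] happens to be
   holomorphic belong to that domain as well. *)
Definition meromorphic_off_reals f :=
  forall z, nonreal z -> hol f z \/ pole f z.

Definition symmetric_on (D : set C) f :=
  forall z, D z -> D z^* /\ f z^* = (f z)^*.

Definition sharp f : C -> C := fun z => (f z^*)^*.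

Definition nevanlinna Q :=
  [/\ forall z, nonreal z -> hol Q z,
      symmetric_on nonreal Q &
      forall z, nonreal z -> 0 <= 'Im (Q z) / 'Im z].

Definition nevkernel Q (z w : C) : C :=
  if z == w^* then derive1 Q z else (Q z - (Q w)^*) / (z - w^*).

(* Number of negative eigenvalues of a Hermitian matrix, with multiplicity. *)
Definition neg_eigenvalues n (M : 'M[C]_n) : nat :=
  count (fun x => x < 0) (sval (closed_field_poly_normal (char_poly M))).

Definition negative_squares (D : set C) (K : C -> C -> C) (kappa : nat) :=
  let gram n (z : 'I_n -> C) := \matrix_(i, j) K (z i) (z j) in
  (forall n (z : 'I_n -> C), (forall i, D (z i)) ->
     (neg_eigenvalues (gram n z) <= kappa)%N) /\
  (exists n (z : 'I_n -> C), (forall i, D (z i)) /\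
     neg_eigenvalues (gram n z) = kappa).

Definition gen_nevanlinna (kappa : nat) Q :=
  [/\ meromorphic_off_reals Q,
      symmetric_on (nonreal `&` hol Q) Q &
      negative_squares (nonreal `&` hol Q) (nevkernel Q) kappa].

Record ratfun := Ratfun {
  rnum : {poly C};
  rden : {poly C};
  rden_neq0 : rden != 0;
  rcoprime : coprimep rnum rden }.

Definition reval (r : ratfun) z : C := (rnum r).[z] / (rden r).[z].
Coercion reval : ratfun >-> Funclass.

Definition rdom (r : ratfun) : set C := [set z | ~~ root (rden r) z].

Definition nonconstant (r : ratfun) :=
  ~ exists c, forall z, rdom r z -> r z = c.

Definition is_rmul (r : ratfun) Q Qt :=
  meromorphic_off_reals Qt /\
  forall z, nonreal z -> hol Qt z -> hol Q z -> rdom r z -> Qt z = r z * Q z.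

Definition gen_nevanlinna_mul (kappa kappat : nat) (r : ratfun) Q :=
  gen_nevanlinna kappa Q /\
  exists2 Qt, is_rmul r Q Qt & gen_nevanlinna kappat Qt.

Definition nonzero Q := exists z, [/\ nonreal z, hol Q z & Q z != 0].

Definition laurent_order Q z (k : int) :=
  exists g : C -> C,
    [/\ hol g z, g z != 0 & \forall w \near z^', Q w = (w - z) ^ k * g w].

(* Nontangential (Stolz angle) limit from the upper half-plane. *)
Definition nt_cvg f (x : R) (l : C) :=
  forall M : R, 0 < M ->
    f z @[z --> within
            [set z : C | 0 < 'Im z /\ `|'Re z - (x%:C : C)| <= (M%:C : C) * 'Im z]
            (nbhs (x%:C : C))] --> l.

Definition nt_limit_npos f (x : R) := exists2 l : C, l <= 0 & nt_cvg f x l.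

Definition real_zero_cond Q (x : R) (n : nat) :=
  nt_limit_npos (fun z => Q z * (z - (x%:C : C)) ^ (1 - 2 * n%:Z)) x.

(* If no n satisfies the condition (as at a generalized pole), the multiplicity
   is 0. *)
Definition real_zero_mult Q (x : R) (n : nat) :=
  (n = 0%N \/ real_zero_cond Q x n) /\
  (forall m, real_zero_cond Q x m -> (m <= n)%N).

Definition real_pole_cond Q (x : R) (n : nat) :=
  nt_limit_npos (fun z => (z - (x%:C : C)) ^+ (2 * n + 1) * Q z) x.

Definition real_pole_mult Q (x : R) (n : nat) :=
  real_pole_cond Q x n /\ (forall m, real_pole_cond Q x m -> (n <= m)%N).

(* [P] is the product of the (z - alpha_i)^(pi_alpha_i) and [D] the product of
   the (z - beta_i)^(kappa_beta_i): monic polynomials determined by the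
   multiplicities of their roots. *)
Definition canonical_divisors Q (P D : {poly C}) :=
  [/\ P \is monic /\ D \is monic,
      forall z : C, 0 < 'Im z -> exists k : int,
        [/\ laurent_order Q z k,
            (mup z P)%:Z = Num.max k 0 & (mup z D)%:Z = Num.max (- k) 0],
      forall x : R, real_zero_mult Q x (mup (x%:C : C) P) /\
                    real_pole_mult Q x (mup (x%:C : C) D) &
      forall z : C, 'Im z < 0 -> mup z P = 0%N /\ mup z D = 0%N].

(* [phi] may be any rational function with phi phi^sharp equal to the canonical
   factor; the choice phi = P / D is one instance. *)
Definition canonical_factorization Q (phi : ratfun) (Q0 : C -> C) :=
  [/\ nevanlinna Q0,
      exists P D : {poly C}, canonical_divisors Q P D /\
        forall z : C, rdom phi z -> rdom phi z^* ->
          ~~ root D z -> ~~ root D z^* ->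
          phi z * sharp phi z
          = (P.[z] * sharp (horner P) z) / (D.[z] * sharp (horner D) z) &
      forall z, nonreal z -> hol Q z -> rdom phi z -> rdom phi z^* ->
        Q z = phi z * sharp phi z * Q0 z].

End Functions.

Section Forms.
Variables (R : realType) (V : lmodType (cplx R)).
Local Notation C := (cplx R).
Variable q : V -> V -> C.

Definition sq_cauchy (u : nat -> V) := forall e : C, 0 < e ->
  exists N, forall m n, (N <= m)%N -> (N <= n)%N ->
    q (u m - u n) (u m - u n) < e.

Definition sq_cvg (u : nat -> V) (l : V) := forall e : C, 0 < e ->
  exists N, forall n, (N <= n)%N -> q (u n - l) (u n - l) < e.

Definition hilbert_on (W : set V) :=
  (forall x, W x -> x != 0 -> 0 < q x x) /\
  (forall u, (forall n, W (u n)) -> sq_cauchy u ->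
     exists2 l, W l & sq_cvg u l).

(* A fundamental decomposition: the finite family [e] is an orthonormal basis of
   the negative component, and its orthogonal complement is a Hilbert space. *)
Definition fundamental (I : finType) (e : I -> V) :=
  (forall i j, q (e i) (e j) = - (i == j)%:R) /\
  hilbert_on [set x | forall i, q x (e i) = 0].

(* The squared norm <f+, f+> - <f-, f-> of the decomposition given by [e]. *)
Definition majorant (I : finType) (e : I -> V) (f : V) : C :=
  q f f + 2 * \sum_i `|q f (e i)| ^+ 2.

End Forms.

Record hilbert (R : realType) := Hilbert {
  hsort :> lmodType (cplx R);
  hform : {dot hsort for (conjC : cplx R -> cplx R)};
  hilbertP : hilbert_on hform setT }.

Record pontryagin (R : realType) := Pontryagin {
  psort :> lmodType (cplx R);
  pform : {hermitian psort for false & (conjC : cplx R -> cplx R)};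
  pontryaginP : exists (I : finType) (e : I -> psort), fundamental pform e }.

Notation "''[' u , v ]" := (pform _ u v) : ring_scope.

Lemma hilbert_fundamental (R : realType) (H : hilbert R) :
  exists (I : finType) (e : I -> H), fundamental (hform H) e.
Proof.
exists 'I_0, (fun=> 0); split; first by case.
rewrite (_ : [set x | _] = setT); first exact: hilbertP.
by apply/seteqP; split=> // x _ [].
Qed.

Definition pontryagin_of_hilbert (R : realType) (H : hilbert R) : pontryagin R :=
  @Pontryagin R H (hform H) (hilbert_fundamental H).
Coercion pontryagin_of_hilbert : hilbert >-> pontryagin.
Canonical pontryagin_of_hilbert.

Section DirectSum.
Variables (R : realType) (K1 K2 : pontryagin R).
Local Notation C := (cplx R).

Definition sum_form (u v : (K1 * K2)%type) : C := '[u.1, v.1] + '[u.2, v.2].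

Fact sum_form_bilinear :
  bilinear_for ( *%R : GRing.Scale.law C C)
    ((conjC : C -> C) \; *%R : GRing.Scale.law C C) sum_form.
Proof.
split=> [w|w] a u v; rewrite /sum_form /=.
  by rewrite !linearPl /= mulrDr addrACA.
by rewrite !linearPr /= mulrDr addrACA.
Qed.
HB.instance Definition _ := bilinear_isBilinear.Build C
  (K1 * K2)%type (K1 * K2)%type C *%R ((conjC : C -> C) \; *%R)
  sum_form sum_form_bilinear.

Fact sum_form_hermitian (u v : (K1 * K2)%type) :
  sum_form u v = (-1) ^+ false * (sum_form v u)^*.
Proof.
rewrite /sum_form expr0 mul1r rmorphD /=.
by rewrite (hermC (pform K1)) (hermC (pform K2)) !expr0 !mul1r.
Qed.
HB.instance Definition _ := isHermitianSesquilinear.Build C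
  (K1 * K2)%type false (conjC : C -> C) sum_form sum_form_hermitian.

Fact sum_fundamental : exists (I : finType) (e : I -> (K1 * K2)%type),
  fundamental sum_form e.
Proof.
have [I1 [e1 [on1 [pos1 cpl1]]]] := pontryaginP K1.
have [I2 [e2 [on2 [pos2 cpl2]]]] := pontryaginP K2.
pose e (i : I1 + I2) : K1 * K2 :=
  match i with inl i => (e1 i, 0) | inr j => (0, e2 j) end.
have sum1 x i : sum_form x (e (inl i)) = '[x.1, e1 i].
  by rewrite /sum_form /= linear0r addr0.
have sum2 x j : sum_form x (e (inr j)) = '[x.2, e2 j].
  by rewrite /sum_form /= linear0r add0r.
have orth x : (forall i, sum_form x (e i) = 0) ->
    (forall i, '[x.1, e1 i] = 0) /\ (forall j, '[x.2, e2 j] = 0).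
  move=> xe; split=> i; first by rewrite -sum1.
  by rewrite -sum2.
have ge01 x : (forall i, '[x, e1 i] = 0) -> 0 <= '[x, x].
  by move=> xe; have [->|/pos1/ltW->//] := eqVneq x 0; rewrite linear0l.
have ge02 x : (forall i, '[x, e2 i] = 0) -> 0 <= '[x, x].
  by move=> xe; have [->|/pos2/ltW->//] := eqVneq x 0; rewrite linear0l.
exists (I1 + I2)%type, e; split; last split.
- case=> i [] j; rewrite ?sum1 ?sum2 /= ?linear0l ?oppr0 ?on1 ?on2 //=.
- move=> x /orth[x1 x2]; rewrite -pair_eqE /= negb_and /sum_form => /orP[].
    by move=> /pos1-/(_ x1) p1; rewrite ltr_wpDr// ge02.
  by move=> /pos2-/(_ x2) p2; rewrite ltr_wpDl// ge01.
- move=> u ue cu.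
  have u1 n i : '[(u n).1, e1 i] = 0 by exact: (orth _ (ue n)).1.
  have u2 n i : '[(u n).2, e2 i] = 0 by exact: (orth _ (ue n)).2.
  have c1 : sq_cauchy (pform K1) (fst \o u).
    move=> eps /cu[N uN]; exists N => m n Nm Nn /=.
    apply: le_lt_trans (uN _ _ Nm Nn); rewrite /sum_form /= lerDl ge02 // => i.
    by rewrite linearBl /= !u2 subrr.
  have c2 : sq_cauchy (pform K2) (snd \o u).
    move=> eps /cu[N uN]; exists N => m n Nm Nn /=.
    apply: le_lt_trans (uN _ _ Nm Nn); rewrite /sum_form /= lerDr ge01 // => i.
    by rewrite linearBl /= !u1 subrr.
  have [l1 l1e ul1] := cpl1 _ u1 c1; have [l2 l2e ul2] := cpl2 _ u2 c2.
  exists (l1, l2).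
    by case=> i; rewrite ?sum1 ?sum2.
  move=> eps eps0; have eps2 : 0 < eps / 2 by rewrite divr_gt0.
  have [[N1 uN1] [N2 uN2]] := (ul1 _ eps2, ul2 _ eps2).
  exists (maxn N1 N2) => n; rewrite geq_max => /andP[/uN1 n1 /uN2 n2].
  by rewrite (splitr eps) ltrD.
Qed.

Definition psum : pontryagin R :=
  @Pontryagin R (K1 * K2)%type sum_form sum_fundamental.

End DirectSum.

Section Relations.
Variables (R : realType) (K : pontryagin R).
Local Notation C := (cplx R).
Implicit Types (A B : set (K * K)) (lambda mu : C).

(* Adjoint in the subspace [W]; in the whole space for [W = setT]. *)
Definition adjoint_in (W : set K) A : set (K * K) :=
  [set g | [/\ W g.1, W g.2 &
               forall f, A f -> '[f.2, g.1] = '[f.1, g.2]]].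

Definition selfadjoint_in (W : set K) A := A = adjoint_in W A.
Definition selfadjoint A := selfadjoint_in setT A.

Definition rel_mul A : set K := [set g | A (0, g)].

Definition rel_comp B A : set (K * K) :=
  [set f | exists2 g, A (f.1, g) & B (g, f.2)].

(* The points at which (B - lambda)^-1 is an everywhere defined bounded operator;
   all majorants of a Pontryagin space are equivalent. *)
Definition resolvent_set B : set C := [set lambda |
  (forall g, exists! f, B (f, g + lambda *: f)) /\
  (exists (I : finType) (e : I -> K), fundamental (pform K) e /\
     exists M : C, forall f g, B (f, g + lambda *: f) ->
       majorant (pform K) e f <= M * majorant (pform K) e g)].

(* (B - lambda)^-1 g *)
Definition resolvent B lambda (g : K) : K :=
  xget 0 [set f | B (f, g + lambda *: f)].

Variable n : nat.
Implicit Types (F : C -> 'M[C]_n) (gamma : C -> 'cV[C]_n -> K).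

Definition adjmx m1 m2 (M : 'M[C]_(m1, m2)) : 'M[C]_(m2, m1) :=
  (map_mx (conjC : C -> C) M)^T.

(* The matrix of gamma_mu^* gamma_lambda. *)
Definition gamma_gram gamma lambda mu : 'M[C]_n :=
  \matrix_(i, j) '[gamma lambda (delta_mx j 0), gamma mu (delta_mx i 0)].

(* The n x n matrix function [F], defined on [DF], is realized via the pair
   [{B, gamma}], where [gamma] is defined on the points of [Dg] in rho(B). *)
Definition realizes (DF : set C) F (Dg : set C) B gamma :=
  let D := resolvent_set B `&` Dg in
  [/\ selfadjoint B,
      resolvent_set B !=set0,
      forall lambda, D lambda -> linear (gamma lambda),
      forall lambda mu, D lambda -> D mu -> forall h,
        gamma lambda h
        = gamma mu h + (lambda - mu) *: resolvent B lambda (gamma mu h) &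
      forall lambda mu, D lambda -> D mu -> DF lambda -> DF mu ->
        F lambda - adjmx (F mu) = (lambda - mu^*) *: gamma_gram gamma lambda mu].

Definition assoc_symmetric B gamma : set (K * K) :=
  [set f | B f /\ forall lambda, resolvent_set B lambda ->
     forall h, '[f.2 - lambda^* *: f.1, gamma lambda h] = 0].

Definition mxnevkernel F (z w : C) : 'M[C]_n :=
  if z == w^* then \matrix_(i, j) derive1 (fun x => F x i j) z
  else (z - w^*)^-1 *: (F z - adjmx (F w)).

(* [K] is the reproducing kernel space on [D] with kernel [N]: [ev] identifies
   its elements with C^n-valued functions on [D]. *)
Definition rk_space (D : set C) (N : C -> C -> 'M[C]_n) (ev : K -> C -> 'cV[C]_n) :=
  [/\ forall z, linear (ev ^~ z),
      forall f, (forall z, D z -> ev f z = 0) -> f = 0 &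
      forall w c, D w -> exists2 k : K,
        (forall z, D z -> ev k z = N z w *m c) &
        (forall f, '[f, k] = (adjmx c *m ev f w) 0 0)].

End Relations.

(* Scalar functions and vector-valued gamma-fields as the case n = 1. *)
Definition scalar_mx1 (R : realType) (F : cplx R -> cplx R) :
  cplx R -> 'M[cplx R]_1 := fun z => (F z)%:M.

Definition scalar_gamma (R : realType) (K : pontryagin R) (gamma : cplx R -> K) :
  cplx R -> 'cV[cplx R]_1 -> K := fun lambda h => h 0 0 *: gamma lambda.

Definition rel_oplus (R : realType) (K1 K2 : pontryagin R)
    (S1 : set (K1 * K1)) (S2 : set (K2 * K2)) : set (psum K1 K2 * psum K1 K2) :=
  [set f | S1 (f.1.1, f.2.1) /\ S2 (f.1.2, f.2.2)].

Section Models.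
Variables (R : realType) (H : hilbert R).
Local Notation C := (cplx R).
Implicit Types (A B T : set (H * H)) (lambda : C).

(* H minus mul A, and the operator part A_o of A *)
Definition mul_perp A : set H := [set f | forall g, rel_mul A g -> '[f, g] = 0].
Definition op_part A : set (H * H) := [set f | A f /\ mul_perp A f.2].

Definition nonneg_selfadjoint_op (W : set H) T :=
  [/\ selfadjoint_in W T,
      forall g, T (0, g) -> g = 0 &
      forall f, T f -> 0 <= '[f.2, f.1]].

(* |B| = (B^* B)^(1/2), everything in the space [W]. *)
Definition is_modulus (W : set H) B T :=
  nonneg_selfadjoint_op W T /\ rel_comp T T = rel_comp (adjoint_in W B) B.

Definition is_sqrt (W : set H) B T :=
  nonneg_selfadjoint_op W T /\ rel_comp T T = B.

(* The objects entering the definition of H_{+1}(B, oo) and H_{-1}(B, oo) for a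
   selfadjoint relation [B]; the completion is determined up to isomorphism and
   everything else is unique. *)
Record rigging B := Rigging {
  rg_P : H -> H;                                                  (* P_oo *)
  rg_PP : forall f, mul_perp B (rg_P f) /\ rel_mul B (f - rg_P f);
  rg_abs : set (H * H);                                          (* |B_o| *)
  rg_absP : is_modulus (mul_perp B) (op_part B) rg_abs;
  rg_sqrt : set (H * H);                                   (* |B_o|^(1/2) *)
  rg_sqrtP : is_sqrt (mul_perp B) rg_abs rg_sqrt;
  rg_res : H -> H;                               (* (I + |B_o|)^-1 P_oo *)
  rg_resP : forall f, rg_abs (rg_res f, rg_P f - rg_res f);
  rg_neg : hilbert R;                                      (* H_{-1}(B, oo) *)
  rg_emb : {linear H -> rg_neg};
  rg_embP : forall f g,
    '[rg_emb f, rg_emb g] = '[f - rg_P f, g] + '[rg_res f, rg_P g];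
  rg_dense : forall (x : rg_neg) (e : C), 0 < e ->
    exists h, '[x - rg_emb h, x - rg_emb h] < e }.

Section Rigged.
Variables (B : set (H * H)) (rg : rigging B).

(* H_{+1}(B, oo), and its open balls of squared radius [e] around 0 *)
Definition hplus : set H := [set f | exists g, rg_sqrt rg (rg_P rg f, g)].
Definition hplus_ball (e : C) : set H :=
  [set f | exists2 g, rg_sqrt rg (rg_P rg f, g) & '[f, f] + '[g, g] < e].

(* The closure of B as a relation from H_{+1}(B, oo) to H_{-1}(B, oo) *)
Definition rel_closure : set (H * rg_neg rg) :=
  [set f | hplus f.1 /\ forall e : C, 0 < e ->
     exists g, [/\ B g, hplus_ball e (f.1 - g.1) &
       '[f.2 - rg_emb rg g.2, f.2 - rg_emb rg g.2] < e]].

(* [c] is the value of the duality (f, x), for [f] in H_{+1} and [x] in H_{-1}: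
   the limit of (f, h) as [h] in H tends to [x] in H_{-1}. *)
Definition duality (f : H) (x : rg_neg rg) (c : C) :=
  forall e : C, 0 < e -> exists2 d : C, 0 < d &
    forall h, '[rg_emb rg h - x, rg_emb rg h - x] < d -> `|'[f, h] - c| < e.

End Rigged.

(* A for xi = oo ([None]), (A - xi)^-1 for real xi: the relation whose rigging
   gives H_{+1}(A, xi) and H_{-1}(A, xi). *)
Definition base A (xi : option R) : set (H * H) :=
  if xi is Some x then [set f | A (f.2, f.1 + (x%:C : C) *: f.2)] else A.

Definition model_gamma A (xi : option R) (rg : rigging (base A xi))
    (omega : rg_neg rg) lambda (g : H) :=
  match xi with
  | None => rel_closure (g, omega + lambda *: rg_emb rg g)
  | Some x => exists2 chi, rel_closure (rg := rg) (g, chi) &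
                rg_emb rg g + ((x%:C : C) - lambda) *: chi = omega
  end.

Definition model_weyl A (xi : option R) (rg : rigging (base A xi))
    (omega : rg_neg rg) (eta : R) lambda (g : H) (w : C) :=
  exists2 c, duality g omega c &
    w = (eta%:C : C) +
        (if xi is Some x then (lambda - (x%:C : C)) * c else c).

(* The Weyl function is compared with [F] only where [F] is defined; on rho(A)
   this leaves out at most real points. *)
Definition model_realizes A (xi : option R) (rg : rigging (base A xi))
    (omega : rg_neg rg) (eta : R) (gamma : C -> H) (F : C -> C) :=
  forall lambda, resolvent_set A lambda ->
    model_gamma omega lambda (gamma lambda) /\
    (hol F lambda -> model_weyl omega eta lambda (gamma lambda) (F lambda)).

End Models.

Section Coupling.
Variable R : realType.
Local Notation C := (cplx R).

Definition Phi_mx (phi : ratfun R) (z : C) : 'M[C]_2 :=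
  \matrix_(i, j) if i == j then 0 else if i == 0 then phi z else sharp phi z.

Definition Phi_dom (phi : ratfun R) : set C :=
  [set z | rdom phi z /\ rdom phi z^*].

Definition coupled_gamma (H : hilbert R) (K : pontryagin R) (phi : ratfun R)
    (Q0 : C -> C) (gamma0 : C -> H) (gammaPhi : C -> 'cV[C]_2 -> K) :
    C -> psum H K :=
  fun z => (phi z *: gamma0 z,
            gammaPhi z (\col_i if i == 0 then Q0 z * phi z else 1)).

Definition coupled_dom (H : hilbert R) (K : pontryagin R) (phi : ratfun R)
    (Q0 : C -> C) (A : set (H * H)) (APhi : set (K * K)) : set C :=
  resolvent_set A `&` resolvent_set APhi `&` hol Q0 `&` Phi_dom phi.

End Coupling.

(* Main.v *)
Require Import Defs.
From mathcomp Require Import all_boot all_order all_algebra.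
From mathcomp Require Import all_classical all_reals.
From mathcomp Require Import topology normedtype derive.
From mathcomp Require Import complex.
From mathcomp Require Import ring.
Import Order.TTheory GRing.Theory Num.Theory Num.Def.

Set Implicit Arguments.
Unset Strict Implicit.
Unset Printing Implicit Defensive.

Local Open Scope classical_set_scope.
Local Open Scope ring_scope.

(* With [g_l = gammaPhi_l e_1] and [gam_l = gamma0_l], let [A0] be the relation
   with resolvent
     (u, v) |-> ( (A - l)^-1 u + h gam_l , (APhi - l)^-1 v + c g_l ),
     h = <v, g_l'>,  c = <u, gam_l'> + Q0(l) h,  l' the conjugate of l.
   It does not depend on [l], and it is selfadjoint, because [<g_l, g_k>]
   vanishes ([Phi] has zero diagonal).  The resolvent equation of the coupled
   gamma-field and the identity for [Q = phi phi^# Q0] then follow from those of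
   the two pairs.  For the first pair they are read off the rigged-space model:
   the closure of [A] from H_+1 to H_-1 contains no element of [H * H] outside
   [A] and is symmetric for the duality.  For the second pair one needs [rho(APhi)]
   to be symmetric and cofinite, which holds because the kernel of the rational
   function [Phi] has finite rank, so that its reproducing kernel space is finite
   dimensional. *)

(** * Forms and majorants *)

(** The resolvent of [A0] is given by Krein's formula for the orthogonal sum of [A] and [APhi], with
    gamma-fields [gam] and [g] and Weyl function diag(Q0, 0), at the parameter that exchanges the
    two coordinates. The matrix to invert has rows (- Q0, 1) and (1, 0); its determinant is -1 for
    every l, and its inverse, with rows (0, 1) and (1, Q0), supplies the coefficients h and c. Hence
    no zero of a determinant has to be avoided, and every l in [coupled_dom] is regular for the
    coupled relation. What shapes the proof is the conjugate point l': the coefficients pair with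
    gamma-fields at l', so [coupled_dom] has to be closed under conjugation. For [A] this is von
    Neumann's theorem. In a Pontryagin space a nonreal point may be an eigenvalue of a selfadjoint
    relation, so for [APhi] it is deduced from finite dimension. *)

Section Scalars.
Variable R : realType.
Local Notation C := (cplx R).

(** Stated for bare scalars, so that one discriminant argument serves the form, the majorant, the
    distance to a subspace and the sum of three forms in [duality_bound]. *)
Lemma cauchy_schwarz_of_quadratic (p r s : C) : 0 <= p -> 0 <= r ->
  (forall a : C, 0 <= p + a * s^* + a^* * s + a * a^* * r) ->
  `|s| ^+ 2 <= p * r.
Proof.
move=> p0 r0 q0; rewrite normCK.
have [r00|rn0] := eqVneq r 0.
  rewrite r00 mulr0.
  have [->|sn0] := eqVneq s 0; first by rewrite mul0r.
  have ss : 0 < s * s^* by rewrite mul_conjC_gt0.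
  (* For r = 0 the expression is affine in a; this t gives it the negative value p - 2 (p + 1) at a
     = - t s. *)
  pose t : C := (p + 1) / (s * s^*).
  have tr : t^* = t.
    by apply/eqP; rewrite -CrealE ger0_real// divr_ge0 ?addr_ge0// ltW.
  have := q0 (- (t * s)).
  rewrite r00 mulr0 addr0 rmorphN rmorphM /= tr.
  have -> : p + - (t * s) * s^* + - (t * s^*) * s = p - (p + 1) * 2.
    have -> : p + - (t * s) * s^* + - (t * s^*) * s = p - t * (s * s^*) * 2.
      by ring.
    by rewrite /t divfK// gt_eqF.
  have p2 : 0 < p + 2 by rewrite ltr_wpDl.
  have -> : p - (p + 1) * 2 = - (p + 2) by ring.
  by rewrite oppr_ge0 => /(lt_le_trans p2); rewrite ltxx.
have rr : r^* = r by apply/eqP; rewrite -CrealE ger0_real.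
have := q0 (- (s / r)); rewrite rmorphN rmorphM /= fmorphV /= rr.
have -> : p + - (s / r) * s^* + - (s^* / r) * s + - (s / r) * - (s^* / r) * r
    = (p * r - s * s^*) / r by field.
by rewrite pmulr_lge0 ?subr_ge0// invr_gt0 lt_def rn0.
Qed.

Lemma sqr_normD_le (a b : C) : `|a + b| ^+ 2 <= 2 * `|a| ^+ 2 + 2 * `|b| ^+ 2.
Proof.
rewrite -subr_ge0; suff -> : 2 * `|a| ^+ 2 + 2 * `|b| ^+ 2 - `|a + b| ^+ 2
  = `|a - b| ^+ 2 by rewrite exprn_ge0.
by rewrite !normCK !rmorphD rmorphN /=; ring.
Qed.

End Scalars.

Section Form.
Variables (R : realType) (K : pontryagin R).
Local Notation C := (cplx R).
Implicit Types x y z : K.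

Lemma pformC x y : '[x, y] = '[y, x]^*.
Proof. by rewrite (hermC (pform K)) expr0 mul1r. Qed.

Lemma pformDl x y z : '[x + y, z] = '[x, z] + '[y, z].
Proof. exact: linearDl. Qed.
Lemma pformBl x y z : '[x - y, z] = '[x, z] - '[y, z].
Proof. exact: linearBl. Qed.
Lemma pformNl x z : '[- x, z] = - '[x, z].
Proof. exact: linearNl. Qed.
Lemma pformZl (a : C) x z : '[a *: x, z] = a * '[x, z].
Proof. exact: linearZl_LR. Qed.
Lemma pformDr x y z : '[z, x + y] = '[z, x] + '[z, y].
Proof. exact: linearDr. Qed.
Lemma pformBr x y z : '[z, x - y] = '[z, x] - '[z, y].
Proof. exact: linearBr. Qed.
Lemma pformNr x z : '[z, - x] = - '[z, x].
Proof. exact: linearNr. Qed.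
Lemma pformZr (a : C) x z : '[z, a *: x] = a^* * '[z, x].
Proof. exact: (linearZr_LR (pform K)). Qed.
Lemma pform0l z : '[0, z] = 0 :> C.
Proof. exact: linear0l. Qed.
Lemma pform0r z : '[z, 0] = 0 :> C.
Proof. exact: linear0r. Qed.
Definition pformE := (pformDl, pformBl, pformNl, pformZl, pformDr, pformBr,
  pformNr, pformZr, pform0l, pform0r).
Lemma pform_suml I (s : seq I) (P : pred I) (F : I -> K) z :
  '[\sum_(i <- s | P i) F i, z] = \sum_(i <- s | P i) '[F i, z].
Proof. exact: linear_sumlz. Qed.
Lemma pform_sumr I (s : seq I) (P : pred I) (F : I -> K) z :
  '[z, \sum_(i <- s | P i) F i] = \sum_(i <- s | P i) '[z, F i].
Proof. exact: linear_sumr. Qed.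

Lemma pform_sqrZ (a : C) x : '[a *: x, a *: x] = `|a| ^+ 2 * '[x, x].
Proof. by rewrite pformZl pformZr mulrA normCK. Qed.

Lemma pform_real x : '[x, x] \is Num.real.
Proof. by rewrite CrealE -pformC. Qed.

Lemma cauchy_schwarz_span x y : (forall a : C, 0 <= '[x + a *: y, x + a *: y]) ->
  0 <= '[y, y] -> `|'[x, y]| ^+ 2 <= '[x, x] * '[y, y].
Proof.
move=> pos y0; apply: cauchy_schwarz_of_quadratic => //.
  by have := pos 0; rewrite scale0r addr0.
move=> a; have := pos a; rewrite !pformE -(pformC y x).
by congr (0 <= _); ring.
Qed.

Section Majorant.
Variables (I : finType) (e : I -> K).
Hypothesis fe : fundamental (pform K) e.
Local Notation maj := (majorant (pform K) e).

(** The projection onto the positive component; the sign is + because <e_i, e_i> = -1. *)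
Let fplus x := x + \sum_i '[x, e i] *: e i.

Let fplus_orth x i : '[fplus x, e i] = 0.
Proof.
rewrite /fplus pformDl pform_suml (bigD1 i)//= pformZl fe.1 eqxx big1 => [|j ji].
  by rewrite addr0 mulrN mulr1 subrr.
by rewrite pformZl fe.1 (negbTE ji) oppr0 mulr0.
Qed.

Let fplus_ge0 x : 0 <= '[fplus x, fplus x].
Proof.
have [->|x0] := eqVneq (fplus x) 0; first by rewrite pform0l.
by apply/ltW/(fe.2.1 _ _ x0) => i; exact: fplus_orth.
Qed.

Let majE x : maj x = '[fplus x, fplus x] + \sum_i `|'[x, e i]| ^+ 2.
Proof.
have -> : '[fplus x, fplus x] = '[fplus x, x].
  rewrite {2}/fplus pformDr pform_sumr big1 ?addr0// => i _.
  by rewrite pformZr fplus_orth mulr0.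
rewrite /majorant /fplus pformDl pform_suml -addrA; congr (_ + _).
rewrite mulr_natl mulr2n; congr (_ + _); apply: eq_bigr => i _.
by rewrite pformZl (pformC (e i)) normCK.
Qed.

Lemma majorant_ge0 x : 0 <= maj x.
Proof. by rewrite majE addr_ge0// sumr_ge0// => i _; rewrite exprn_ge0. Qed.

Lemma majorantZ (a : C) x : maj (a *: x) = `|a| ^+ 2 * maj x.
Proof.
rewrite /majorant !pformE mulrA -normCK mulrDr; congr (_ + _).
rewrite !mulr_sumr; apply: eq_bigr => i _.
by rewrite pformE normrM exprMn mulrCA.
Qed.

Lemma majorant_parallelogram x y :
  maj (x + y) + maj (x - y) = 2 * maj x + 2 * maj y.
Proof.
rewrite /majorant !pformE.
have -> : \sum_i `|'[x + y, e i]| ^+ 2 =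
    2 * \sum_i `|'[x, e i]| ^+ 2 + 2 * \sum_i `|'[y, e i]| ^+ 2
    - \sum_i `|'[x - y, e i]| ^+ 2.
  rewrite !mulr_sumr -big_split -sumrB /=; apply: eq_bigr => i _.
  by rewrite !pformE !normCK !rmorphD rmorphN /=; ring.
by ring.
Qed.

Lemma majorantD x y : maj (x + y) <= 2 * maj x + 2 * maj y.
Proof. by rewrite -majorant_parallelogram lerDl majorant_ge0. Qed.

Lemma majorant_definite x : maj x = 0 -> x = 0.
Proof.
rewrite majE => /eqP; rewrite paddr_eq0 ?fplus_ge0//; last first.
  by rewrite sumr_ge0// => i _; rewrite exprn_ge0.
move=> /andP[/eqP f0].
rewrite psumr_eq0 => [|i _]; last by rewrite exprn_ge0.
move=> /allP e0; have [/eqP|fn0] := eqVneq (fplus x) 0.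
  rewrite /fplus big1 ?addr0 => [/eqP//|i _].
  have /e0 : i \in index_enum I by rewrite mem_index_enum.
  by rewrite /= sqrf_eq0 normr_eq0 => /eqP ->; rewrite scale0r.
by have /(_ fn0) := fe.2.1 (fplus x) (fplus_orth x); rewrite f0 ltxx.
Qed.

(* With the fundamental symmetry [J y = y + 2 sum <y, e_i> e_i], the majorant is
   [<x, J x>] and [<x, y>] is its polarization at [x], [J y]. *)
Lemma majorant_form_bound y : exists2 N : C, 0 <= N &
  forall x, `|'[x, y]| ^+ 2 <= N * maj x.
Proof.
have [Jy JyE] : exists z, z = y + 2 *: \sum_i '[y, e i] *: e i by eexists.
exists (maj Jy) => [|x]; first exact: majorant_ge0.
have Jye i : '[Jy, e i] = - '[y, e i].
  rewrite JyE pformDl pformZl pform_suml (bigD1 i)//= pformZl fe.1 eqxx.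
  rewrite big1 => [|j ji]; first by rewrite addr0 mulrN mulr1; ring.
  by rewrite pformZl fe.1 (negbTE ji) oppr0 mulr0.
rewrite mulrC; apply: cauchy_schwarz_of_quadratic; rewrite ?majorant_ge0// => a.
have := majorant_ge0 (x + a *: Jy).
suff -> : maj (x + a *: Jy) =
    maj x + a * '[x, y]^* + a^* * '[x, y] + a * a^* * maj Jy by [].
have E : \sum_i `|'[x + a *: Jy, e i]| ^+ 2 =
    \sum_i `|'[x, e i]| ^+ 2 + a * a^* * \sum_i `|'[Jy, e i]| ^+ 2
    - a * (\sum_i '[x, e i] * '[y, e i]^*)^*
    - a^* * \sum_i '[x, e i] * '[y, e i]^*.
  rewrite rmorph_sum /= !mulr_sumr -!big_split -!sumrB /=.
  apply: eq_bigr => i _; rewrite !pformE Jye !normCK !rmorphD !rmorphM /=.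
  by rewrite conjCK rmorphN /=; ring.
have F : '[x, Jy] = '[x, y] + 2 * \sum_i '[x, e i] * '[y, e i]^*.
  rewrite JyE pformDr pformZr conjC_nat pform_sumr; congr (_ + 2 * _).
  by apply: eq_bigr => i _; rewrite pformZr mulrC.
rewrite /majorant E !pformE (pformC Jy x) F rmorphD rmorphM /= conjC_nat.
by ring.
Qed.

(** Finite-rank corrections of a bounded resolvent stay bounded; [regular_of_injective] needs
    this. *)
Lemma majorant_bounded_finite_rank n (a b : 'I_n -> K) : exists2 N : C, 0 <= N &
  forall x, maj (\sum_i '[x, a i] *: b i) <= N * maj x.
Proof.
elim: n a b => [|n IHn] a b.
  exists 0 => // x; rewrite big_ord0 mul0r.
  by rewrite -(scale0r 0) majorantZ normr0 expr0n mul0r.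
have [N N0 bN] := IHn (fun i => a (lift ord0 i)) (fun i => b (lift ord0 i)).
have [M M0 bM] := majorant_form_bound (a ord0).
exists (2 * (M * maj (b ord0)) + 2 * N) => [|x].
  by rewrite addr_ge0 ?mulr_ge0 ?majorant_ge0.
rewrite big_ord_recl; apply: le_trans (majorantD _ _) _.
rewrite [leRHS]mulrDl; apply: lerD; rewrite -!mulrA ler_pM2l//.
by rewrite majorantZ (mulrC (maj _)) mulrA ler_wpM2r ?majorant_ge0.
Qed.

(** [d] is an arbitrary family, so the bound applies to [sum_negbasis e1 e2] without a proof that
    this family is fundamental. Together with [majorant_sum_le] it compares a majorant of a sum
    space with those of the summands. *)
Lemma majorant_le (J : finType) (d : J -> K) : exists2 N : C, 0 <= N &
  forall x, majorant (pform K) d x <= N * maj x.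
Proof.
have /choice[N bN] : forall j, exists N : C, 0 <= N /\
    forall x, `|'[x, d j]| ^+ 2 <= N * maj x.
  by move=> j; have [N N0 bN] := majorant_form_bound (d j); exists N.
exists (1 + 2 * \sum_j N j) => [|x].
  by rewrite addr_ge0 ?mulr_ge0 ?sumr_ge0// => j _; exact: (bN j).1.
rewrite [leRHS]mulrDl mul1r /majorant; apply: lerD.
  by rewrite lerDl mulr_ge0 ?sumr_ge0// => i _; rewrite exprn_ge0.
rewrite -mulrA ler_pM2l// mulr_suml ler_sum// => j _; exact: (bN j).2.
Qed.

End Majorant.

Lemma pform_nondegenerate x : (forall y, '[x, y] = 0) -> x = 0.
Proof.
move=> x0; have [I [e fe]] := pontryaginP K.
apply: (majorant_definite fe); rewrite /majorant x0 big1 ?mulr0 ?addr0// => i _.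
by rewrite x0 normr0 expr0n.
Qed.

Lemma pform_inj x y : (forall z, '[x, z] = '[y, z]) -> x = y.
Proof.
move=> xy; apply/eqP; rewrite -subr_eq0; apply/eqP/pform_nondegenerate => z.
by rewrite pformBl xy subrr.
Qed.

End Form.

Section SumSpace.
Variables (R : realType) (K1 K2 : pontryagin R).
Local Notation C := (cplx R).

Lemma psum_formE (u v : psum K1 K2) :
  '[u, v] = '[u.1, v.1] + '[u.2, v.2] :> C.
Proof. by []. Qed.

Variables (I1 I2 : finType) (e1 : I1 -> K1) (e2 : I2 -> K2).

Definition sum_negbasis (i : I1 + I2) : psum K1 K2 :=
  match i with inl i => (e1 i, 0) | inr j => (0, e2 j) end.

Lemma sum_negbasis_l (u : psum K1 K2) i :
  '[u, sum_negbasis (inl i)] = '[u.1, e1 i].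
Proof. by rewrite psum_formE /= pform0r addr0. Qed.

Lemma sum_negbasis_r (u : psum K1 K2) i :
  '[u, sum_negbasis (inr i)] = '[u.2, e2 i].
Proof. by rewrite psum_formE /= pform0r add0r. Qed.

Lemma majorant_sum (u : psum K1 K2) : majorant (pform (psum K1 K2)) sum_negbasis u
  = majorant (pform K1) e1 u.1 + majorant (pform K2) e2 u.2.
Proof.
rewrite /majorant psum_formE big_sumType.
rewrite (eq_bigr (fun i => `|'[u.1, e1 i]| ^+ 2)) => [|i _]; last first.
  by rewrite sum_negbasis_l.
rewrite [X in _ + 2 * (_ + X)](eq_bigr (fun i => `|'[u.2, e2 i]| ^+ 2)).
  by ring.
by move=> i _; rewrite sum_negbasis_r.
Qed.

Hypotheses (f1 : fundamental (pform K1) e1) (f2 : fundamental (pform K2) e2).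

Lemma majorant_sum_le (J : finType) (d : J -> psum K1 K2) : exists2 N : C, 0 <= N &
  forall u, majorant (pform (psum K1 K2)) d u <=
    N * (majorant (pform K1) e1 u.1 + majorant (pform K2) e2 u.2).
Proof.
have /choice[N bN] : forall j, exists N : C, 0 <= N /\ forall u : psum K1 K2,
    `|'[u, d j]| ^+ 2 <=
      N * (majorant (pform K1) e1 u.1 + majorant (pform K2) e2 u.2).
  move=> j; have [N N0 bN] := majorant_form_bound f1 (d j).1.
  have [M M0 bM] := majorant_form_bound f2 (d j).2.
  exists (2 * N + 2 * M); split => [|u]; first by rewrite addr_ge0 ?mulr_ge0.
  rewrite psum_formE; set x := '[u.1, _]; set y := '[u.2, _].
  apply: le_trans (sqr_normD_le _ _) _; have hx : `|x| ^+ 2 <= _ := bN u.1.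
  have hy : `|y| ^+ 2 <= _ := bM u.2.
  have := majorant_ge0 f1 u.1; have := majorant_ge0 f2 u.2.
  move: (majorant _ _ u.1) (majorant _ _ u.2) hx hy => m1 m2 hx hy m20 m10.
  have -> : (2 * N + 2 * M) * (m1 + m2) =
      2 * (N * m1) + 2 * (M * m2) + (2 * N * m2 + 2 * M * m1) by ring.
  apply: ler_wpDr; first by rewrite addr_ge0 ?mulr_ge0.
  by apply: lerD; rewrite ler_pM2l.
exists (1 + 2 * \sum_j N j) => [|u].
  by rewrite addr_ge0 ?mulr_ge0 ?sumr_ge0// => j _; exact: (bN j).1.
rewrite [leRHS]mulrDl mul1r /majorant; apply: lerD.
  rewrite psum_formE lerD// lerDl mulr_ge0 ?sumr_ge0// => i _;
  by rewrite exprn_ge0.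
rewrite -mulrA ler_pM2l// mulr_suml ler_sum// => j _; exact: (bN j).2.
Qed.

End SumSpace.

(** * Selfadjoint relations in Hilbert spaces *)

Section Small.
Variable R : realType.
Local Notation C := (cplx R).

(** Small e <= 1 suffice, which lets [rel_closure_sym] bound squares of errors below e by e
    itself. *)
Lemma eq0_of_small (x c : C) : 0 <= x -> 0 <= c ->
  (forall e : C, 0 < e -> e <= 1 -> x <= e * c) -> x = 0.
Proof.
move=> x0 c0 xe; apply/eqP; have [//|xn0] := eqVneq x 0.
have xp : 0 < x by rewrite lt_def xn0.
have c1 : 0 < c + x + 1 by rewrite ltr_wpDl ?addr_ge0.
have e1 : x / (c + x + 1) <= 1.
  by rewrite ler_pdivrMr// mul1r -addrA ler_wpDl// lerDl.
have := xe _ (divr_gt0 xp c1) e1.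
rewrite mulrAC ler_pdivlMr// ler_pM2l// -addrA gerDl.
by move=> /(lt_le_trans (ltr_wpDl x0 ltr01)); rewrite ltxx.
Qed.

(** The order of [C] is partial, hence ab / (a + b) in place of a minimum. *)
Lemma pos_common_bound (a b : C) : 0 < a -> 0 < b ->
  exists e : C, [/\ 0 < e, e <= a & e <= b].
Proof.
move=> a0 b0; have ab : 0 < a + b by rewrite addr_gt0.
exists (a * b / (a + b)); split; first by rewrite divr_gt0 ?mulr_gt0.
  by rewrite ler_pdivrMr// ler_pM2l// lerDr ltW.
by rewrite ler_pdivrMr// mulrC ler_pM2l// lerDl ltW.
Qed.

Lemma exists_invSn_lt (e : C) : 0 < e -> exists n : nat, n.+1%:R^-1 < e.
Proof.
move=> e0; have er : e \is Num.real by rewrite realE ltW.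
have [r re] : exists r : R, e = r%:C%C by exists (complex.Re e); rewrite RRe_real.
have r0 : 0 < r by move: e0; rewrite re ltcR.
have [n] := ltr_add_invr r0; rewrite add0r => nr.
by exists n; rewrite re -(rmorph_nat (real_complex R)) -fmorphV /= ltcR.
Qed.

End Small.

Section Projection.
Variables (R : realType) (K : pontryagin R).
Local Notation C := (cplx R).
Hypothesis pos : forall x : K, 0 <= '[x, x] :> C.

Lemma cauchy_schwarz (x y : K) : `|'[x, y]| ^+ 2 <= '[x, x] * '[y, y].
Proof. exact: cauchy_schwarz_span. Qed.

Variable W : set K.
Hypotheses (W0 : W 0) (WD : forall (a : C) x y, W x -> W y -> W (x + a *: y)).
Hypothesis W_complete : forall u, (forall n, W (u n)) -> sq_cauchy (pform K) u ->
  exists2 l, W l & sq_cvg (pform K) u l.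

Lemma distance_exists (u : K) : exists d : C,
  (forall w, W w -> d <= '[u - w, u - w]) /\
  forall n, exists2 w, W w & '[u - w, u - w] < d + n.+1%:R^-1.
Proof.
pose S : set R := [set t | exists2 w, W w & '[u - w, u - w] = t%:C%C].
have Sw w : W w -> S (complex.Re '[u - w, u - w]).
  by move=> Ww; exists w => //; rewrite RRe_real// pform_real.
have S0 : S !=set0 by exists (complex.Re '[u - 0, u - 0]); exact: Sw.
have lS : has_lbound S.
  by exists 0 => t [w _ wt]; have := pos (u - w); rewrite wt lecR.
exists (inf S)%:C%C; split=> [w Ww|n].
  rewrite -(RRe_real (pform_real (u - w))) lecR; apply: ge_inf => //; exact: Sw.
have n0 : 0 < (n.+1%:R^-1 : R) by rewrite invr_gt0 ltr0Sn.
have [t [w Ww wt] tn] := inf_adherent n0 (conj S0 lS).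
exists w => //.
by rewrite wt -(rmorph_nat (real_complex R)) -fmorphV -rmorphD /= ltcR.
Qed.

(** Formulated in a Pontryagin space with positive form because it is applied in the graph space
    [psum H H], with a selfadjoint relation as [W]. *)
Lemma orthogonal_projection (u : K) :
  exists2 p, W p & forall w, W w -> '[u - p, w] = 0.
Proof.
have [d [dW dn]] := distance_exists u.
have /choice[w wP] : forall n, exists w, W w /\
    '[u - w, u - w] < d + n.+1%:R^-1.
  by move=> n; have [w] := dn n; exists w.
have Ww n := (wP n).1; have wd n := (wP n).2.
have WN x y : W x -> W y -> W (2^-1 *: (x + y)).
  move=> Wx Wy; have := WD 2^-1 W0 (WD 1 Wx Wy).
  by rewrite add0r scale1r.
have wc : sq_cauchy (pform K) w.
  (* By the parallelogram law the squared distance of w_m and w_n is less than 2 (d + e/4) + 2 (d +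
     e/4) - 4 d = e. *)
  move=> e e0; have [|N Ne] := @exists_invSn_lt _ (e / 4).
    by rewrite divr_gt0.
  exists N => m n mN nN; set v := 2^-1 *: (w m + w n).
  have -> : '[w m - w n, w m - w n] = 2 * '[u - w m, u - w m] +
      2 * '[u - w n, u - w n] - 4 * '[u - v, u - v].
    have c2 : (2^-1 : C)^* = 2^-1 by rewrite fmorphV rmorph_nat.
    by rewrite /v !pformE c2; field.
  have near_d k : (N <= k)%N -> 2 * '[u - w k, u - w k] < 2 * d + e / 2.
    move=> kN; have -> : 2 * d + e / 2 = 2 * (d + e / 4) by field.
    rewrite ltr_pM2l//; apply: lt_trans (wd k) _; rewrite ltrD2l.
    by apply: le_lt_trans Ne; rewrite lef_pV2 ?posrE ?ltr0Sn// ler_nat.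
  have dv : 4 * d <= 4 * '[u - v, u - v].
    by rewrite ler_pM2l// dW//; exact: WN.
  have -> : e = 2 * d + e / 2 + (2 * d + e / 2) - 4 * d by field.
  by apply: ltr_leB => //; apply: ltrD; exact: near_d.
have [p Wp wp] := W_complete Ww wc.
exists p => // x Wx.
(* Moving w_n along x cannot bring the squared distance below d, so the quadratic with constant term
   <u - w_n, u - w_n> - d is nonnegative; its discriminant gives near-orthogonality. *)
have orth_n n : `|'[u - w n, x]| ^+ 2 <= n.+1%:R^-1 * '[x, x].
  apply: (@le_trans _ _ (('[u - w n, u - w n] - d) * '[x, x])); last first.
    by rewrite ler_wpM2r// lerBlDl ltW.
  apply: cauchy_schwarz_of_quadratic => // [|a]; first by rewrite subr_ge0 dW.
  have := dW _ (WD (- a) (Ww n) Wx); rewrite -subr_ge0.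
  have -> : u - (w n + - a *: x) = (u - w n) + a *: x.
    by rewrite opprD scaleNr opprK addrA.
  move: (u - w n) => v; rewrite !pformE -(pformC x v).
  by congr (0 <= _); ring.
apply/eqP; rewrite -normr_eq0 -sqrf_eq0; apply/eqP.
apply: (@eq0_of_small _ _ (4 * '[x, x])) => [||e e0 _].
- by rewrite exprn_ge0.
- by rewrite mulr_ge0.
have [N Ne] := exists_invSn_lt e0; have [M Me] := wp _ e0.
pose n := maxn N M.
have h1 : `|'[u - w n, x]| ^+ 2 <= e * '[x, x].
  apply: le_trans (orth_n n) _; rewrite ler_wpM2r//; apply: ltW.
  by apply: le_lt_trans Ne; rewrite lef_pV2 ?posrE ?ltr0Sn// ler_nat ltnS leq_maxl.
have h2 : `|'[w n - p, x]| ^+ 2 <= e * '[x, x].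
  apply: le_trans (cauchy_schwarz _ _) _; rewrite ler_wpM2r//; apply: ltW.
  by apply: Me; rewrite leq_maxr.
have -> : u - p = (u - w n) + (w n - p) by rewrite addrA subrK.
rewrite pformDl; move: '[u - w n, x] '[w n - p, x] h1 h2 => a b h1 h2.
apply: le_trans (sqr_normD_le _ _) _.
have -> : e * (4 * '[x, x]) = 2 * (e * '[x, x]) + 2 * (e * '[x, x]) by ring.
by apply: lerD; rewrite ler_pM2l.
Qed.

End Projection.

Section Selfadjoint.
Variables (R : realType) (K : pontryagin R).
Local Notation C := (cplx R).
Variable A : set (K * K).
Hypothesis sA : selfadjoint A.

Lemma selfadjointP g : A g <-> forall f, A f -> '[f.2, g.1] = '[f.1, g.2].
Proof.
rewrite {1}sA /adjoint_in /=; split=> [[]//|h]; by split.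
Qed.

Lemma selfadjoint_sym f g : A f -> A g -> '[f.2, g.1] = '[f.1, g.2].
Proof. by move=> Af /selfadjointP; exact. Qed.

Lemma selfadjoint_comb (a : C) f g : A f -> A g -> A (f + a *: g).
Proof.
move=> Af Ag; apply/selfadjointP => h Ah /=.
by rewrite !pformE (selfadjoint_sym Ah Af) (selfadjoint_sym Ah Ag).
Qed.

Lemma selfadjoint0 : A 0.
Proof. by apply/selfadjointP => f _ /=; rewrite !pformE. Qed.

Lemma selfadjointZ (a : C) f : A f -> A (a *: f).
Proof.
by move=> Af; rewrite -[a *: f]add0r; exact: selfadjoint_comb selfadjoint0 Af.
Qed.

Lemma selfadjointB f g : A f -> A g -> A (f - g).
Proof. by move=> Af Ag; rewrite -scaleN1r; exact: selfadjoint_comb. Qed.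

End Selfadjoint.

Section VonNeumann.
Variables (R : realType) (H : hilbert R).
Local Notation C := (cplx R).

Lemma hilbert_form_ge0 (x : H) : 0 <= '[x, x] :> C.
Proof.
have [->|x0] := eqVneq x 0; first by rewrite pform0l.
by apply: ltW; exact: (hilbertP H).1.
Qed.

Lemma hilbert_form_eq0 (x : H) : '[x, x] = 0 -> x = 0.
Proof.
move=> xx; apply/eqP; apply/negPn/negP => /((hilbertP H).1 x I).
by rewrite [X in 0 < X]xx ltxx.
Qed.

Lemma hilbert_cauchy_schwarz (x y : H) :
  `|'[x, y]| ^+ 2 <= '[x, x] * '[y, y].
Proof. by apply: cauchy_schwarz => z; exact: hilbert_form_ge0. Qed.

Lemma hilbert_normD_le (x y : H) :
  '[x + y, x + y] <= 2 * '[x, x] + 2 * '[y, y].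
Proof.
rewrite -subr_ge0.
suff -> : 2 * '[x, x] + 2 * '[y, y] - '[x + y, x + y] = '[x - y, x - y].
  exact: hilbert_form_ge0.
by rewrite !pformE; ring.
Qed.

(** Two arguments move together because the condition defining an adjoint involves both components
    of a graph element; this is how a selfadjoint relation is seen to be closed. *)
Lemma form_limit_eq (a b x y : H) (c : C) :
  (forall e : C, 0 < e -> exists x' y' : H, [/\ '[x' - x, x' - x] < e,
     '[y' - y, y' - y] < e & '[a, x'] + '[b, y'] = c]) ->
  '[a, x] + '[b, y] = c.
Proof.
move=> app; apply/eqP; rewrite -subr_eq0 -normr_eq0 -sqrf_eq0; apply/eqP.
apply: (@eq0_of_small _ _ (2 * '[a, a] + 2 * '[b, b])) => [||e e0 _].
- by rewrite exprn_ge0.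
- by rewrite addr_ge0 ?mulr_ge0 ?hilbert_form_ge0.
have [x' [y' [xe ye <-]]] := app _ e0.
have -> : '[a, x] + '[b, y] - ('[a, x'] + '[b, y']) =
    - '[a, x' - x] + - '[b, y' - y] by rewrite !pformE; ring.
apply: le_trans (sqr_normD_le _ _) _; rewrite !normrN mulrDr.
rewrite ![e * (2 * _)]mulrCA; apply: lerD; rewrite ler_pM2l//.
  apply: le_trans (hilbert_cauchy_schwarz _ _) _.
  by rewrite mulrC ler_wpM2r ?hilbert_form_ge0// ltW.
apply: le_trans (hilbert_cauchy_schwarz _ _) _.
by rewrite mulrC ler_wpM2r ?hilbert_form_ge0// ltW.
Qed.

Variable A : set (H * H).
Hypothesis sA : selfadjoint A.

Lemma selfadjoint_complete (u : nat -> psum H H) : (forall n, A (u n)) ->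
  sq_cauchy (pform (psum H H)) u ->
  exists2 l, A l & sq_cvg (pform (psum H H)) u l.
Proof.
move=> Au cu.
have ge0 := hilbert_form_ge0.
have [l1 _ ul1] : exists2 l, setT l & sq_cvg (hform H) (fst \o u) l.
  apply: (hilbertP H).2 => // e /cu[N uN]; exists N => m n mN nN.
  by apply: le_lt_trans (uN _ _ mN nN); rewrite psum_formE lerDl ge0.
have [l2 _ ul2] : exists2 l, setT l & sq_cvg (hform H) (snd \o u) l.
  apply: (hilbertP H).2 => // e /cu[N uN]; exists N => m n mN nN.
  by apply: le_lt_trans (uN _ _ mN nN); rewrite psum_formE lerDr ge0.
exists (l1, l2); last first.
  move=> e e0; have e2 : 0 < e / 2 by rewrite divr_gt0.
  have [[N1 uN1] [N2 uN2]] := (ul1 _ e2, ul2 _ e2).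
  exists (maxn N1 N2) => n; rewrite geq_max => /andP[/uN1 n1 /uN2 n2].
  by rewrite (splitr e) psum_formE ltrD.
apply/(selfadjointP sA) => f Af /=.
apply/eqP; rewrite -subr_eq0 -pformNl; apply/eqP.
apply: form_limit_eq => e e0.
have [[N1 uN1] [N2 uN2]] := (ul1 _ e0, ul2 _ e0).
exists (u (maxn N1 N2)).1, (u (maxn N1 N2)).2; split.
- by apply: uN1; rewrite leq_maxl.
- by apply: uN2; rewrite leq_maxr.
- by rewrite pformNl (selfadjoint_sym sA Af (Au _)) subrr.
Qed.

(* Write [(0, u) = (f, f') + (- h', h)] with [(f, f')] in the closed subspace [A]
   and [(- h', h)] orthogonal to it, so that [A (h, h')] by [A = A^*]: then [f = h']
   and [f + i h] is a solution. *)
Lemma selfadjoint_range_i (u : H) : exists f, A (f, u + 'i *: f).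
Proof.
have [p Ap orth] := @orthogonal_projection R (psum H H)
  (fun x => addr_ge0 (hilbert_form_ge0 _) (hilbert_form_ge0 _)) A
  (selfadjoint0 sA) (fun a x y Ax Ay => selfadjoint_comb sA a Ax Ay)
  selfadjoint_complete (0, u).
have Ah : A (u - p.2, p.1).
  apply/(selfadjointP sA) => f Af /=.
  have /(congr1 conjC) := orth _ Af; rewrite psum_formE /= rmorphD /= -!pformC.
  rewrite conjC0 sub0r pformNr => /eqP; rewrite addrC subr_eq0 => /eqP.
  exact.
exists (p.1 + 'i *: (u - p.2)).
have := selfadjoint_comb sA 'i Ap Ah; congr (A _).
rewrite [p]surjective_pairing /=; congr (_, _) => /=.
rewrite scalerDr scalerA -expr2 sqrCi scaleN1r opprB addrCA.
by rewrite [u + _]addrC subrK addrC.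
Qed.

End VonNeumann.

Section NonrealResolvent.
Variables (R : realType) (H : hilbert R).
Local Notation C := (cplx R).
Variable A : set (H * H).
Hypothesis sA : selfadjoint A.

(** With l = x + i y, the relation B = (A - x) / y is selfadjoint and A - l = y (B - i), which
    reduces the claim to the point i. *)
Lemma selfadjoint_range (l : C) (u : H) : 'Im l != 0 ->
  exists f, A (f, u + l *: f).
Proof.
move=> yn0; set y := 'Im l in yn0 *; set x := 'Re l.
have yr : y^* = y by apply/eqP; rewrite -CrealE Creal_Im.
have xr : x^* = x by apply/eqP; rewrite -CrealE Creal_Re.
pose B : set (H * H) := [set f | A (f.1, y *: f.2 + x *: f.1)].
have sB : selfadjoint B.
  apply/seteqP; split=> [g Bg|g [_ _ Bg]].
    split=> // f Bf; apply: (mulfI yn0).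
    have := selfadjoint_sym sA Bf Bg; rewrite /= !pformE xr yr.
    by move/addIr.
  apply/(selfadjointP sA) => f Af /=.
  have /Bg /= : B (f.1, y^-1 *: (f.2 - x *: f.1)).
    rewrite /B /= scalerA divff// scale1r subrK.
    by case: f Af.
  rewrite !pformE yr xr => /(congr1 ( *%R y)).
  by rewrite mulrA divff// mul1r => /eqP; rewrite subr_eq => /eqP.
have [f Bf] := selfadjoint_range_i sB (y^-1 *: u).
exists f; move: Bf; rewrite /B /= scalerDr !scalerA divff// scale1r.
by rewrite -addrA -scalerDl [y * _]mulrC [_ + x]addrC -Crect.
Qed.

(** For f' = g + l f with l = x + i y, symmetry of [A] gives |g|^2 = |f' - x f|^2 + y^2 |f|^2, and
    f' - x f = g + i y f. *)
Lemma selfadjoint_lower_bound (l : C) (f g : H) : A (f, g + l *: f) ->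
  ('Im l) ^+ 2 * '[f, f] <= '[g, g].
Proof.
move=> Af; have := selfadjoint_sym sA Af Af => /= sym.
set y := 'Im l; set x := 'Re l.
have yr : y^* = y by apply/eqP; rewrite -CrealE Creal_Im.
have lE : l = x + 'i * y by exact: Crect.
have le : l^* = x - 'i * y by rewrite lE conjC_rect ?Creal_Re ?Creal_Im.
have fgE : '[f, g] = '[g, f] + 2 * 'i * y * '[f, f].
  have symE : '[g, f] + (x + 'i * y) * '[f, f] = '[f, g] + (x - 'i * y) * '[f, f].
    by rewrite -lE -le -pformZl -pformZr -pformDl -pformDr.
  have -> : '[g, f] = '[f, g] + (x - 'i * y) * '[f, f] - (x + 'i * y) * '[f, f].
    by rewrite -symE addrK.
  by ring.
rewrite -subr_ge0; have := hilbert_form_ge0 (g + ('i * y) *: f).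
have ii : 'i * 'i = -1 :> C by rewrite -expr2 sqrCi.
suff -> : '[g + ('i * y) *: f, g + ('i * y) *: f] = '[g, g] - y ^+ 2 * '[f, f].
  by [].
rewrite !pformE fgE rmorphM /= conjCi yr.
transitivity ('[g, g] + ('i * 'i) * y ^+ 2 * '[f, f]); first by ring.
by rewrite ii; ring.
Qed.

Lemma nonreal_resolvent (l : C) : 'Im l != 0 -> resolvent_set A l.
Proof.
move=> yn0; have yr : 'Im l \is Num.real by exact: Creal_Im.
have y2 : 0 < 'Im l ^+ 2 by rewrite real_exprn_even_gt0// yn0.
split=> [g|].
  have [f Af] := selfadjoint_range g yn0; exists f; split=> // f' Af'.
  have := selfadjointB sA Af Af'.
  have -> : ((f, g + l *: f) : H * H) - (f', g + l *: f')
      = (f - f', 0 + l *: (f - f')).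
    by congr (_, _); rewrite /= add0r scalerBr opprD addrACA subrr add0r.
  move=> /selfadjoint_lower_bound; rewrite pform0l => ff.
  have : '[f - f', f - f'] <= 0 by rewrite -(pmulr_rle0 _ y2).
  move=> ff0; apply/eqP; rewrite -subr_eq0; apply/eqP/hilbert_form_eq0.
  by apply/eqP; rewrite eq_le ff0 hilbert_form_ge0.
exists 'I_0, (fun=> 0); split.
  split; first by case.
  rewrite (_ : [set x | _] = setT); first exact: hilbertP.
  by apply/seteqP; split=> // x _ [].
exists (('Im l ^+ 2)^-1) => f g /selfadjoint_lower_bound fg.
by rewrite /majorant !big_ord0 !mulr0 !addr0 mulrC ler_pdivlMr// mulrC.
Qed.

Lemma hilbert_resolvent_conj (l : C) : resolvent_set A l -> resolvent_set A l^*.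
Proof.
have [l0|l0 _] := eqVneq ('Im l) 0.
  suff -> : l^* = l by [].
  by apply/eqP; rewrite -CrealE; apply/Creal_ImP.
by apply: nonreal_resolvent; rewrite Im_conj oppr_eq0.
Qed.

End NonrealResolvent.

(** * Rigged-space models *)

Section Rigging.
Variables (R : realType) (H : hilbert R).
Local Notation C := (cplx R).
Variable B : set (H * H).
Hypothesis sB : selfadjoint B.
Variable rg : rigging B.
Local Notation emb := (rg_emb rg).
Local Notation P := (rg_P rg).

Lemma dom_perp_mul f g : B f -> rel_mul B g -> '[f.1, g] = 0.
Proof. by move=> Bf /(selfadjoint_sym sB Bf); rewrite pform0r. Qed.

Lemma rg_P_perp f g : '[P f, g - P g] = 0.
Proof. by have [Wf _] := rg_PP rg f; have [_ /Wf] := rg_PP rg g. Qed.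

Lemma rg_P_id f : mul_perp B f -> P f = f.
Proof.
move=> Wf; apply/esym/eqP; rewrite -subr_eq0; apply/eqP/hilbert_form_eq0.
have [_ mf] := rg_PP rg f.
by rewrite [X in X = _]pformBl (Wf _ mf) rg_P_perp subrr.
Qed.

Lemma rg_sqrt_sym f g : rg_sqrt rg f -> rg_sqrt rg g -> '[f.2, g.1] = '[f.1, g.2].
Proof.
have [[SE _ _] _] := rg_sqrtP rg => Sf.
by rewrite {1}SE => -[_ _]; exact.
Qed.

(** The form is bounded for the norms of H_{-1} and H_{+1}. With r = (I + |B_o|)^-1 P x and t =
    |B_o|^(1/2) r, the squared H_{-1} norm of x is |x - P x|^2 + |r|^2 + |t|^2, and <x, h> = <x - P
    x, h - P h> + <r, P h> + <t, s>: Cauchy-Schwarz in three copies of H. *)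
Lemma duality_bound (x h s : H) : rg_sqrt rg (P h, s) ->
  `|'[x, h]| ^+ 2 <= '[emb x, emb x] * ('[h, h] + '[s, s]).
Proof.
move=> Sh; have := rg_resP rg x; set r := rg_res rg x.
have [_ <-] := rg_sqrtP rg => -[t /= Srt Str].
have tt : '[P x - r, r] = '[t, t] := rg_sqrt_sym Str Srt.
have ts : '[P x - r, P h] = '[t, s] := rg_sqrt_sym Str Sh.
have xp : '[x - P x, P h] = 0 by rewrite pformC rg_P_perp conjC0.
have px : '[P x, h - P h] = 0 := rg_P_perp x h.
have xx : '[x - P x, P x] = 0 by rewrite pformC rg_P_perp conjC0.
have hh : '[h - P h, P h] = 0 by rewrite pformC rg_P_perp conjC0.
have hh' : '[P h, h - P h] = 0 := rg_P_perp h h.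
have -> : '[emb x, emb x] = '[x - P x, x - P x] + '[r, r] + '[t, t].
  rewrite (rg_embP rg) -/r -addrA; congr (_ + _); first by rewrite pformBr xx subr0.
  rewrite -[P x in LHS](subrK r) pformDr addrC; congr (_ + _).
  by rewrite pformC tt -pformC.
have -> : '[h, h] = '[h - P h, h - P h] + '[P h, P h].
  rewrite -{1 2}(subrK (P h) h) pformDl pformDr.
  by rewrite [X in _ + X = _]pformDr hh hh' addr0 add0r.
have -> : '[x, h] = '[x - P x, h - P h] + '[r, P h] + '[t, s].
  rewrite -ts -addrA -pformDl [r + _]addrC subrK.
  rewrite -{1}(subrK (P x) x) -{1}(subrK (P h) h) pformDl.
  rewrite pformDr [X in _ + X = _]pformDr xp px.
  by rewrite addr0 add0r.
have ge0 := @hilbert_form_ge0 R H.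
apply: cauchy_schwarz_of_quadratic; rewrite ?addr_ge0// => a.
have := addr_ge0 (addr_ge0 (ge0 (x - P x + a *: (h - P h))) (ge0 (r + a *: P h)))
  (ge0 (t + a *: s)).
move: (P h) (h - P h) (x - P x) => w v u; congr (0 <= _).
rewrite !pformDl !pformDr !pformZl !pformZr (pformC v u) (pformC w r) (pformC s t).
by rewrite !rmorphD /=; ring.
Qed.

(** The modulus is known only through its square, |B_o|^2 = B_o^* B_o. So elements of H_{+1} are
    produced in dom B^2: if x is in dom B, then h = (B - i)^-1 x is in dom B^2, and P h in dom
    |B_o|^2, which is contained in dom |B_o|^(1/2). *)
Lemma rg_sqrt_exists f : B f -> exists2 h, B (h, f.1 + 'i *: h) &
  exists s, rg_sqrt rg (P h, s).
Proof.
move=> Bf; have [h Bh] := selfadjoint_range_i sB f.1.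
exists h => //; set z := f.1 + 'i *: h in Bh *.
have Bz : B (z, f.2 + 'i *: z).
  by have := selfadjoint_comb sB 'i Bf Bh; congr (B _).
have W g : B g -> mul_perp B g.1 by move=> Bg m; exact: dom_perp_mul.
set w := f.2 + _ in Bz; have [Ww mw] := rg_PP rg w.
(* Removing the multivalued part of w brings the second component into [mul_perp B], where the
   operator part acts. *)
have Bzw : B (z, P w).
  have := selfadjointB sB Bz mw; congr (B _).
  by congr (_, _); rewrite /= ?subr0// opprB addrC subrK.
have : rel_comp (rg_abs rg) (rg_abs rg) (h, P w).
  have [_ ->] := rg_absP rg; exists z => /=.
    by split=> //; exact: W Bz.
  split=> [||g [Bg _]] /=; [exact: W Bz|exact: Ww|].
  exact: (selfadjoint_sym sB Bg Bzw).
move=> [t /= ht _]; move: ht; have [_ <-] := rg_sqrtP rg => -[s /= hs _].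
by exists s; rewrite rg_P_id//; exact: W Bh.
Qed.

(** Closure of [B] in H x H_{-1}: weaker than membership in [rel_closure], as the H_{+1} norm
    dominates that of H. *)
Definition approximable f (k : H) := forall e : C, 0 < e -> exists p,
  [/\ B p, '[f - p.1, f - p.1] < e & '[emb (k - p.2), emb (k - p.2)] < e].

Lemma approximable_mul f k m : approximable f k -> rel_mul B m -> '[m, f] = 0.
Proof.
move=> app mm; rewrite -[RHS](pform0l f) -[LHS]addr0 -(pform0l f).
rewrite [in RHS]pform0l; apply: form_limit_eq => e e0.
have [p [Bp pe _]] := app _ e0; exists p.1, f; split.
- by rewrite -opprB pformNl pformNr opprK.
- by rewrite subrr pform0l.
- by rewrite pform0l addr0 pformC (dom_perp_mul Bp mm) conjC0.
Qed.

(** [k] is approached in the norm of H_{-1} only, so the limit can be taken against elements of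
    H_{+1}; hence the condition on h.1. *)
Lemma approximable_sym f k h s : approximable f k -> B h ->
  rg_sqrt rg (P h.1, s) -> '[k, h.1] = '[f, h.2].
Proof.
move=> app Bh Sh; apply/eqP; rewrite -subr_eq0 -normr_eq0 -sqrf_eq0; apply/eqP.
have ge0 := @hilbert_form_ge0 R H.
apply: (@eq0_of_small _ _ (2 * ('[h.1, h.1] + '[s, s]) + 2 * '[h.2, h.2])).
- by rewrite exprn_ge0.
- by rewrite !addr_ge0 ?mulr_ge0 ?addr_ge0.
move=> e e0 _; have [p [Bp pe pe']] := app _ e0.
have -> : '[k, h.1] - '[f, h.2] = '[k - p.2, h.1] + - '[f - p.1, h.2].
  by rewrite !pformBl (selfadjoint_sym sB Bp Bh); ring.
apply: le_trans (sqr_normD_le _ _) _; rewrite normrN mulrDr.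
rewrite ![e * (2 * _)]mulrCA; apply: lerD; rewrite ler_pM2l//.
  apply: le_trans (duality_bound _ Sh) _.
  by apply: ler_wpM2r; [rewrite addr_ge0|exact: ltW].
apply: le_trans (hilbert_cauchy_schwarz _ _) _.
by rewrite ler_wpM2r// ltW.
Qed.

(* Testing on the elements [h = (B - i)^-1 x] with [x] in [dom B], which lie in
   [dom |B_o| subset H_+1], shows that [(B + i)^-1 (k + i f) - f] is orthogonal
   to [dom B]; it is also orthogonal to [mul B]. *)
Lemma approximable_mem f k : approximable f k -> B (f, k).
Proof.
move=> app.
have nI : 'Im (- 'i : C) != 0 by rewrite raddfN /= Im_i oppr_eq0 oner_eq0.
have [g Bg] := selfadjoint_range sB (k + 'i *: f) nI.
suff gf : g - f = 0.
  have -> : f = g by apply/esym/eqP; rewrite -subr_eq0 gf.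
  move: Bg; rewrite -(subrK f g) gf add0r.
  by rewrite scaleNr addrK.
have mgf : rel_mul B (g - f).
  apply/(selfadjointP sB) => x Bx; rewrite pform0r.
  have [h Bh [s Sh]] := rg_sqrt_exists Bx.
  have e1 : '[k, h] = '[f, x.1 + 'i *: h] := approximable_sym app Bh Sh.
  have e2 : '[k + 'i *: f + - 'i *: g, h] = '[g, x.1 + 'i *: h] :=
    selfadjoint_sym sB Bg Bh.
  suff gx : '[g - f, x.1] = 0.
    by transitivity ('[g - f, x.1]^*); [rewrite gx rmorph0|exact/esym/pformC].
  apply/eqP; rewrite pformBl subr_eq0; apply/eqP.
  move: e2; rewrite !pformE e1 !pformE conjCi => e2.
  apply: (addIr (- 'i * '[g, h])); rewrite -e2; ring.
apply: hilbert_form_eq0; rewrite [X in X = _]pformBl.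
rewrite [X in X - _](dom_perp_mul Bg mgf) pformC (approximable_mul app mgf).
by rewrite conjC0 subrr.
Qed.

(** The second components that occur in the models involve omega and need not lie in H; in suitable
    combinations omega cancels, and these are pairs of [B] itself. *)
Lemma rel_closure_comb (a b : C) f g chi psi k :
  rel_closure (rg := rg) (f, chi) -> rel_closure (rg := rg) (g, psi) ->
  a *: chi + b *: psi = emb k -> B (a *: f + b *: g, k).
Proof.
move=> [/= _ cf] [/= _ cg] kE; apply: approximable_mem => e e0.
pose M := 2 * `|a| ^+ 2 + 2 * `|b| ^+ 2 + 1.
have M0 : 0 < M by rewrite ltr_wpDl// addr_ge0// mulr_ge0// exprn_ge0.
have eM : 0 < e / M by rewrite divr_gt0.
have comb (L : hilbert R) (x y : L) : '[x, x] < e / M -> '[y, y] < e / M ->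
    '[a *: x + b *: y, a *: x + b *: y] < e.
  move=> xe ye; apply: le_lt_trans (hilbert_normD_le _ _) _.
  rewrite !pform_sqrZ (mulrA 2) (mulrA 2 (`|b| ^+ 2)).
  apply: (@le_lt_trans _ _ (2 * `|a| ^+ 2 * (e / M) + 2 * `|b| ^+ 2 * (e / M))).
    by apply: lerD; apply: ler_wpM2l; rewrite ?mulr_ge0 ?exprn_ge0//; exact: ltW.
  by rewrite -mulrDl mulrA ltr_pdivrMr// mulrC ltr_pM2l// ltrDl ltr01.
have [p [Bp [s _ ps] pe]] := cf _ eM; have [q [Bq [t _ qt] qe]] := cg _ eM.
have drop (x y d : C) : 0 <= y -> x + y < d -> x < d.
  by move=> y0; apply: le_lt_trans; rewrite lerDl.
exists (a *: p + b *: q); split.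
- by have := selfadjoint_comb sB b (selfadjointZ sB a Bp) Bq.
- rewrite /= opprD addrACA -!scalerBr; apply: comb.
    exact: drop (hilbert_form_ge0 _) ps.
  exact: drop (hilbert_form_ge0 _) qt.
- have -> : emb (k - (a *: p + b *: q).2) =
      a *: (chi - emb p.2) + b *: (psi - emb q.2).
    rewrite linearB -kE linearD !linearZ /= !scalerBr opprD.
    exact: addrACA.
  exact: comb.
Qed.

Lemma duality_emb f k c : duality f (emb k) c -> c = '[f, k].
Proof.
move=> fk; apply/esym/eqP; rewrite -subr_eq0 -normr_eq0; apply/eqP.
apply: (@eq0_of_small _ _ 1) => // e e0 _.
have [d d0 /(_ k)] := fk _ e0; rewrite subrr pform0l mulr1 => h.
by apply: ltW; exact: h.
Qed.

(** Second components in the models have the form a (omega + k) with k in H: a = 1 and k = l gamma_l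
    for xi = oo, a = (xi - l)^-1 and k = - gamma_l for real xi. *)
Lemma duality_affine f x (a : C) c k : duality f x c -> a != 0 ->
  duality f (a *: (x + emb k)) (a^* * (c + '[f, k])).
Proof.
move=> fx a0 e e0; have na : 0 < `|a| by rewrite normr_gt0.
have [d d0 fxd] := fx _ (divr_gt0 e0 na).
exists (`|a| ^+ 2 * d) => [|h hd]; first by rewrite mulr_gt0// exprn_gt0.
have : '[emb (a^-1 *: h - k) - x, emb (a^-1 *: h - k) - x] < d.
  rewrite -(ltr_pM2l (exprn_gt0 2 na)); apply: le_lt_trans hd.
  have -> : emb h - a *: (x + emb k) = a *: (emb (a^-1 *: h - k) - x).
    have -> : emb (a^-1 *: h - k) = a^-1 *: emb h - emb k.
      by rewrite linearB linearZ.
    rewrite !scalerBr scalerDr scalerA divff// scale1r opprD.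
    by rewrite addrA addrAC.
  by rewrite [leRHS]pform_sqrZ.
move=> /fxd; rewrite ltr_pdivlMr// mulrC -(norm_conjC a) -normrM => h1.
apply: le_lt_trans h1.
rewrite pformBr pformZr fmorphV; set u := '[f, h]; set v := '[f, k].
have -> : a^* * ((a^*)^-1 * u - v - c) = u - a^* * (c + v).
  by have an : a^* != 0 := (ltac:(by rewrite fmorph_eq0)); field.
by [].
Qed.

(** Symmetry of [B] survives in the closure: replace both elements by approximants p and q in [B],
    for which <p.2, q.1> = <p.1, q.2>, and control the four resulting errors. *)
Lemma rel_closure_sym f g chi psi c d :
  rel_closure (rg := rg) (f, chi) -> rel_closure (rg := rg) (g, psi) ->
  duality f psi c -> duality g chi d -> c = d^*.
Proof.
move=> [/= _ cf] [/= _ cg] fc gd.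
apply/eqP; rewrite -subr_eq0 -normr_eq0 -sqrf_eq0; apply/eqP.
(* Of the four errors, the two from [duality] have squares at most e, the two from [duality_bound]
   at most e (2 <z, z> + 2) with z = psi, chi; the factors 2 come from splitting the sum twice. *)
pose M := 2 * (2 * (1 + (2 * '[psi, psi] + 2))) + 2 * (2 * (1 + (2 * '[chi, chi] + 2))).
have pge0 := @hilbert_form_ge0 R (rg_neg rg).
apply: (@eq0_of_small _ _ M) => [||e e0 e1].
- by rewrite exprn_ge0.
- by rewrite !(addr_ge0, mulr_ge0).
have [d1 d10 fd1] := fc _ e0; have [d2 d20 gd2] := gd _ e0.
have [e2 [e20 e2d1 e2d2]] := pos_common_bound d10 d20.
have [e3 [e30 e3e e3e2]] := pos_common_bound e0 e20.
have [p [Bp [s Ss ps] pe]] := cf _ e30; have [q [Bq [t St qt] qe]] := cg _ e30.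
have flip (L : hilbert R) (x y : L) : '[x - y, x - y] = '[y - x, y - x].
  by rewrite -(opprB y x) pformNl pformNr opprK.
have cn : `|'[f, q.2] - c| < e.
  apply: fd1; rewrite flip; apply: lt_le_trans qe _.
  exact: le_trans e3e2 e2d1.
have dn : `|'[g, p.2] - d| < e.
  apply: gd2; rewrite flip; apply: lt_le_trans pe _.
  exact: le_trans e3e2 e2d2.
have small (x : C) : `|x| < e -> `|x| ^+ 2 <= e.
  move=> xe; apply: (@le_trans _ _ (`|x| * 1)).
    by rewrite expr2 ler_wpM2l// (le_trans (ltW xe)).
  by rewrite mulr1 ltW.
have bound y (z : rg_neg rg) (h r : H) : rg_sqrt rg (P h, r) ->
    '[h, h] + '[r, r] < e3 -> '[z - emb y, z - emb y] < e3 ->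
    `|'[y, h]| ^+ 2 <= e * (2 * '[z, z] + 2).
  move=> Sh he ze; apply: le_trans (duality_bound y Sh) _.
  rewrite mulrC; apply: ler_pM.
  - by rewrite addr_ge0 ?hilbert_form_ge0.
  - exact: pge0.
  - exact: le_trans (ltW he) e3e.
  have -> : emb y = z + (emb y - z) by rewrite addrC subrK.
  apply: le_trans (hilbert_normD_le _ _) _; rewrite lerD2l.
  rewrite -[leRHS]mulr1 ler_pM2l// flip.
  exact: le_trans (ltW ze) (le_trans e3e e1).
have b1 := bound _ _ _ _ Ss ps qe; have b2 := bound _ _ _ _ St qt pe.
have -> : c - d^* = (- ('[f, q.2] - c) + '[q.2, f - p.1]^*) +
    (('[g, p.2] - d)^* + - '[p.2, g - q.1]).
  rewrite -pformC rmorphB /= -pformC !pformBl !pformBr.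
  by rewrite (selfadjoint_sym sB Bp Bq); ring.
have {}cn := small _ cn; have {}dn := small _ dn.
apply: le_trans (sqr_normD_le _ _) _; rewrite /M mulrDr.
rewrite ![e * (2 * (2 * _))]mulrCA; apply: lerD; rewrite ler_pM2l//;
  apply: le_trans (sqr_normD_le _ _) _;
  rewrite ?normrN ?norm_conjC -mulrDr mulrCA ler_pM2l// mulrDr mulr1;
  by apply: lerD.
Qed.

End Rigging.

Section Model.
Variables (R : realType) (H : hilbert R).
Local Notation C := (cplx R).
Variable A : set (H * H).
Hypothesis sA : selfadjoint A.

Lemma base_selfadjoint xi : selfadjoint (base A xi).
Proof.
case: xi => [x|//]; set X : C := x%:C%C.
have xr : X^* = X by apply/eqP; rewrite -CrealE complex_real.
apply/seteqP; split=> [g Bg|g [_ _ Bg]].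
  split=> // f Bf; have := selfadjoint_sym sA Bf Bg.
  by rewrite [LHS]pformDl [RHS]pformDr pformZl pformZr xr => /addIr/esym.
apply/(selfadjointP sA) => f Af.
have /Bg Bfg : base A (Some x) (f.2 - X *: f.1, f.1).
  by rewrite /base /= subrK; case: f Af.
have {Bfg} : '[f.1, g.1] = '[f.2 - X *: f.1, g.2] := Bfg.
rewrite pformBl pformZl => E; rewrite [RHS]pformDr pformZr xr E.
by rewrite [RHS]subrK.
Qed.

Variables (xi : option R) (rg : rigging (base A xi)) (omega : rg_neg rg).
Variables (eta : R) (gamma : C -> H) (F : C -> C).
Hypothesis real_F : model_realizes omega eta gamma F.

Let sB := base_selfadjoint xi.

(** The resolvent equation in graph form. Omega cancels with coefficients 1 and -1 for xi = oo, and
    with l - xi and xi - m for real xi. *)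
Lemma model_gamma_resolvent (l m : C) : resolvent_set A l -> resolvent_set A m ->
  A (gamma l - gamma m, l *: gamma l - m *: gamma m).
Proof.
move=> /real_F[+ _] /real_F[+ _].
case: xi rg omega sB => [x|] rg' om sB'.
  set X : C := x%:C%C => -[chi cl gl] [psi cm gm].
  have : base A (Some x) ((l - X) *: gamma l + (X - m) *: gamma m, gamma l - gamma m).
    apply: (rel_closure_comb sB' cl cm).
    rewrite -[l - X]opprB scaleNr.
    have -> : (X - l) *: chi = om - rg_emb rg' (gamma l).
      by rewrite -gl addrAC subrr add0r.
    have -> : (X - m) *: psi = om - rg_emb rg' (gamma m).
      by rewrite -gm addrAC subrr add0r.
    rewrite [RHS]linearB -/(rg_emb rg') opprB addrA subrK.
    by [].
  rewrite /base /=; congr (A (_, _)).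
  rewrite -/X scalerBr addrACA -scalerDl -scalerBl subrK.
  have -> : X - m - X = - m by ring.
  by rewrite scaleNr.
move=> cl cm; have := rel_closure_comb (a := 1) (b := -1) sB' cl cm.
rewrite !scale1r !scaleN1r; apply.
have -> : rg_emb rg' (l *: gamma l - m *: gamma m) =
  l *: rg_emb rg' (gamma l) - m *: rg_emb rg' (gamma m).
  by rewrite linearB !linearZ.
by rewrite opprD addrACA subrr add0r.
Qed.

Lemma model_weyl_identity (l m : C) :
  resolvent_set A l -> resolvent_set A m -> hol F l -> hol F m ->
  F l - (F m)^* = (l - m^*) * '[gamma l, gamma m].
Proof.
move=> /real_F[+ +] /real_F[+ +] hl hm => + /(_ hl) + + /(_ hm).
have er : ((eta%:C%C : C))^* = eta%:C%C by apply/eqP; rewrite -CrealE complex_real.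
case: xi rg omega sB => [x|] rg' om sB'; last first.
  move=> cl [c dc ->] cm [d dd ->].
  have dc' := duality_affine (m *: gamma m) dc (oner_neq0 C).
  have dd' := duality_affine (l *: gamma l) dd (oner_neq0 C).
  have embZ k h : rg_emb rg' (k *: h) = k *: rg_emb rg' h by exact: linearZ.
  rewrite !scale1r !embZ in dc' dd'.
  have := rel_closure_sym sB' cl cm dc' dd'.
  rewrite !pformZr !rmorph1 !mul1r !rmorphD !rmorphM /= conjCK -pformC er => E.
  have -> : c = d^* + l * '[gamma l, gamma m] - m^* * '[gamma l, gamma m].
    by rewrite -E addrK.
  by ring.
set X : C := x%:C%C.
have xr : X^* = X by apply/eqP; rewrite -CrealE complex_real.
move=> [chi cl gl] [c dc ->] [psi cm gm] [d dd ->].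
rewrite !rmorphD !rmorphM rmorphB /= er -/X xr.
(* At l = xi one cannot solve for chi, but there omega is the image of gamma_l, and the duality is
   the form of H. *)
have [lX|lX] := eqVneq l X.
  move: gl; rewrite lX subrr scale0r addr0 => gl.
  move: dd; rewrite -gl => /duality_emb ->; rewrite -pformC.
  by ring.
have [mX|mX] := eqVneq m X.
  move: gm; rewrite mX subrr scale0r addr0 => gm.
  move: dc; rewrite -gm => /duality_emb ->; rewrite xr.
  by ring.
have Xl : X - l != 0 by rewrite subr_eq0 eq_sym.
have Xm : X - m != 0 by rewrite subr_eq0 eq_sym.
have dc' := duality_affine (- gamma m) dc (invr_neq0 Xm).
have dd' := duality_affine (- gamma l) dd (invr_neq0 Xl).
have psiE : (X - m)^-1 *: (om + rg_emb rg' (- gamma m)) = psi.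
  by rewrite linearN /= -gm addrAC subrr add0r scalerA mulVf// scale1r.
have chiE : (X - l)^-1 *: (om + rg_emb rg' (- gamma l)) = chi.
  by rewrite linearN /= -gl addrAC subrr add0r scalerA mulVf// scale1r.
rewrite psiE in dc'; rewrite chiE in dd'.
have := rel_closure_sym sB' cl cm dc' dd'.
rewrite !pformNr !rmorphM /= conjCK !fmorphV rmorphB rmorphD rmorphN /= -pformC xr.
have Xm' : X - m^* != 0 by rewrite -xr -rmorphB fmorph_eq0.
set g := '[gamma l, gamma m] => E.
have cE : c = g + (X - m^*) * ((X - l)^-1 * (d^* - g)).
  by rewrite -E mulrA divff// mul1r addrC subrK.
rewrite cE; field.
by rewrite Xl.
Qed.

End Model.

(** * Coupling of two pairs *)

Section ResolventFacts.
Variables (R : realType) (K : pontryagin R).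
Local Notation C := (cplx R).
Variable A : set (K * K).
Hypothesis sA : selfadjoint A.
Implicit Types (l k : C) (gamma : C -> K).

Lemma resolvent_mem l u : resolvent_set A l ->
  A (resolvent A l u, u + l *: resolvent A l u).
Proof.
move=> [/(_ u)[f [Af _]] _].
exact: (@xgetPex _ 0 [set h | A (h, u + l *: h)] (ex_intro _ f Af)).
Qed.

Lemma resolvent_uniq l u f f' : resolvent_set A l ->
  A (f, u + l *: f) -> A (f', u + l *: f') -> f = f'.
Proof. by move=> [/(_ u)[g [_ gu]] _] /gu <- /gu <-. Qed.

(** The right-hand side mentions no resolvent and is linear in the pair, so all gamma-fields below
    are handled in that form. *)
Lemma resolvent_increment l k (x y : K) : resolvent_set A l ->
  x = y + (l - k) *: resolvent A l y <-> A (x - y, l *: x - k *: y).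
Proof.
move=> rl; have Ar := resolvent_mem y rl; split=> [->|Axy].
  have := selfadjointZ sA (l - k) Ar; congr (A (_, _)) => /=.
    by rewrite addrAC subrr add0r.
  rewrite !scalerDr !scalerA addrAC -scalerBl; congr (_ + _ *: _).
  by rewrite mulrC.
have [lk|lk] := eqVneq l k.
  rewrite lk subrr scale0r addr0; apply/eqP; rewrite -subr_eq0; apply/eqP.
  apply: (resolvent_uniq (u := 0) rl); rewrite add0r.
    by move: Axy; rewrite lk scalerBr.
  by rewrite scaler0; exact: selfadjoint0.
have lk0 : l - k != 0 by rewrite subr_eq0.
have -> : resolvent A l y = (l - k)^-1 *: (x - y).
  apply: (resolvent_uniq rl Ar).
  have := selfadjointZ sA (l - k)^-1 Axy; congr (A (_, _)) => /=.
  have -> : l *: x - k *: y = (l - k) *: y + l *: (x - y).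
    by rewrite scalerBl scalerBr [RHS]addrC subrKA.
  rewrite scalerDr scalerA mulVf// scale1r; congr (_ + _).
  by rewrite !scalerA mulrC.
by rewrite scalerA divff// scale1r addrC subrK.
Qed.

Lemma resolvent_bounded l : resolvent_set A l ->
  exists (I : finType) (e : I -> K), fundamental (pform K) e /\
  exists2 M : C, 0 <= M & forall f g, A (f, g + l *: f) ->
    majorant (pform K) e f <= M * majorant (pform K) e g.
Proof.
move=> [_ [I [e [fe [M AM]]]]]; exists I, e; split=> //.
(* [M] itself may fail to be a nonnegative real when every majorant vanishes. *)
exists `|M| => // f g /AM fM.
have f0 := le_trans (majorant_ge0 fe f) fM.
by rewrite -(ger0_norm (majorant_ge0 fe g)) -normrM (ger0_norm f0).
Qed.

(** On [A] the functional <f' - l f, gamma_l'> does not depend on l; this is the source of the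
    independence of l of [coupled]. *)
Lemma defect_pairing_const gamma l k f : A f ->
  A (gamma l^* - gamma k^*, l^* *: gamma l^* - k^* *: gamma k^*) ->
  '[f.2 - l *: f.1, gamma l^*] = '[f.2 - k *: f.1, gamma k^*].
Proof.
move=> Af Ag; have : '[f.2, gamma l^* - gamma k^*] =
    '[f.1, l^* *: gamma l^* - k^* *: gamma k^*] := selfadjoint_sym sA Af Ag.
rewrite !pformE !conjCK => E.
have -> : '[f.2, gamma l^*] = '[f.2, gamma k^*] +
    (l * '[f.1, gamma l^*] - k * '[f.1, gamma k^*]) by rewrite -E addrC subrK.
by ring.
Qed.

End ResolventFacts.

Section Coupling.
Variables (R : realType) (K1 K2 : pontryagin R).
Local Notation C := (cplx R).
Local Notation K := (psum K1 K2).
Variables (A1 : set (K1 * K1)) (A2 : set (K2 * K2)).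
Hypotheses (sA1 : selfadjoint A1) (sA2 : selfadjoint A2).
Variables (D : set C) (gamma : C -> K1) (m : C -> C) (g : C -> K2).
Hypothesis D_conj : forall l, D l -> D l^*.
Hypothesis gamma_increment : forall l k, D l -> D k ->
  A1 (gamma l - gamma k, l *: gamma l - k *: gamma k).
Hypothesis g_increment : forall l k, D l -> D k ->
  A2 (g l - g k, l *: g l - k *: g k).
Hypothesis m_identity : forall l k, D l -> D k ->
  m l - (m k)^* = (l - k^*) * '[gamma l, gamma k].
(** The factor stays because the Gram identity of a pair gives no information when it vanishes. *)
Hypothesis g_isotropic : forall l k, D l -> D k -> (l - k^*) * '[g l, g k] = 0.

(* In terms of the boundary maps of the two pairs, [coeff1] and [coeff2] are
   Gamma_0 of the first and of the second component; the relation imposes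
   Gamma_0 of the one to be Gamma_1 of the other. *)
Definition coeff1 l (x : K * K) : C := '[x.2.2 - l *: x.1.2, g l^*].
Definition coeff2 l (x : K * K) : C :=
  '[x.2.1 - l *: x.1.1, gamma l^*] + m l * coeff1 l x.
Definition coupled l : set (K * K) := [set x |
  A1 (x.1.1 - coeff1 l x *: gamma l, x.2.1 - (l * coeff1 l x) *: gamma l) /\
  A2 (x.1.2 - coeff2 l x *: g l, x.2.2 - (l * coeff2 l x) *: g l)].

Lemma m_conj l : D l -> (m l^*)^* = m l.
Proof.
move=> Dl; apply/esym/eqP; rewrite -subr_eq0; apply/eqP.
by rewrite m_identity ?conjCK ?subrr ?mul0r//; exact: D_conj.
Qed.

(** The two coefficients do not change with the point. For [coeff1] the extra term vanishes by
    isotropy; for [coeff2] the pairing with gamma changes by h (l - k) <gamma_l, gamma_k'>, which is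
    exactly the change of h m. *)
Lemma coupled_sub l k x : D l -> D k -> coupled l x -> coupled k x.
Proof.
move=> Dl Dk [B1 B2]; have [Dl' Dk'] := (D_conj Dl, D_conj Dk).
have h_eq : coeff1 k x = coeff1 l x.
  have := defect_pairing_const sA2 B2 (g_increment Dl' Dk').
  set c := coeff2 l x; rewrite /coeff1.
  have -> : (x.1.2 - c *: g l, x.2.2 - (l * c) *: g l).2 -
      l *: (x.1.2 - c *: g l, x.2.2 - (l * c) *: g l).1 = x.2.2 - l *: x.1.2.
    by rewrite /= scalerBr scalerA opprB addrA subrK.
  move=> ->; rewrite [(_, _).1]/= [(_, _).2]/= !pformE.
  have := g_isotropic Dl Dk'; rewrite conjCK => gg.
  rewrite -[LHS]subr0 -(mulr0 c) -gg; ring.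
have k_eq : coeff2 k x = coeff2 l x.
  have := defect_pairing_const sA1 B1 (gamma_increment Dl' Dk').
  rewrite /coeff2 h_eq; set h := coeff1 l x.
  have -> : (x.1.1 - h *: gamma l, x.2.1 - (l * h) *: gamma l).2 -
      l *: (x.1.1 - h *: gamma l, x.2.1 - (l * h) *: gamma l).1
      = x.2.1 - l *: x.1.1.
    by rewrite /= scalerBr scalerA opprB addrA subrK.
  move=> ->; rewrite [(_, _).1]/= [(_, _).2]/= !pformE.
  have := m_identity Dl Dk'; rewrite conjCK m_conj// => mm.
  have -> : m l = m k + (l - k) * '[gamma l, gamma k^*] by rewrite -mm addrC subrK.
  by ring.
split; rewrite ?h_eq ?k_eq.
  have := selfadjoint_comb sA1 (coeff1 l x) B1 (gamma_increment Dl Dk).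
  congr (A1 (_, _)) => /=; rewrite scalerBr ?scalerA addrA ?subrK//.
  by rewrite [coeff1 l x * l]mulrC [coeff1 l x * k]mulrC subrK.
have := selfadjoint_comb sA2 (coeff2 l x) B2 (g_increment Dl Dk).
congr (A2 (_, _)) => /=; rewrite scalerBr ?scalerA addrA ?subrK//.
by rewrite [coeff2 l x * l]mulrC [coeff2 l x * k]mulrC subrK.
Qed.

(** Green's identity. Reading x at l and w at the conjugate point makes both involve the same
    gamma-fields; the first component then contributes c h'^* - h c'^* and the second its
    negative. *)
Lemma coupled_sym l x w : D l -> coupled l x -> coupled l w ->
  '[x.2, w.1] = '[x.1, w.2].
Proof.
move=> Dl [X1 X2] /(coupled_sub Dl (D_conj Dl))[W1 W2]; have Dl' := D_conj Dl.
have := selfadjoint_sym sA1 X1 W1; have := selfadjoint_sym sA2 X2 W2.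
rewrite [(_, _).1]/= [(_, _).2]/= [(_, _).1]/= [(_, _).2]/= !psum_formE.
have hx : coeff1 l x = '[x.2.2 - l *: x.1.2, g l^*] by [].
have kx : coeff2 l x = '[x.2.1 - l *: x.1.1, gamma l^*] + m l * coeff1 l x by [].
have hw : (coeff1 l^* w)^* = '[g l, w.2.2 - l^* *: w.1.2].
  by rewrite -pformC /coeff1 conjCK.
have kw : (coeff2 l^* w)^* =
    '[gamma l, w.2.1 - l^* *: w.1.1] + m l * (coeff1 l^* w)^*.
  by rewrite /coeff2 rmorphD rmorphM /= m_conj// -pformC conjCK.
move: (coeff1 l x) (coeff2 l x) (coeff1 l^* w) (coeff2 l^* w) hx kx hw kw.
move=> h c h' c' hx kx hw kw; rewrite !pformE !rmorphM /= !conjCK.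
rewrite !pformE !conjCK in hx kx hw kw.
move=> /eqP; rewrite -subr_eq0 => /eqP E2 /eqP; rewrite -subr_eq0 => /eqP E1.
apply/eqP; rewrite -subr_eq0 -[X in _ == X]addr0.
rewrite -[X in _ == X + _]E1 -[X in _ == _ + X]E2; apply/eqP.
have -> : '[x.2.2, g l^*] = h + l * '[x.1.2, g l^*] by rewrite hx subrK.
have -> : '[g l, w.2.2] = h'^* + l * '[g l, w.1.2] by rewrite hw subrK.
have -> : '[x.2.1, gamma l^*] = c - m l * h + l * '[x.1.1, gamma l^*].
  by rewrite kx addrK subrK.
have -> : '[gamma l, w.2.1] = c'^* - m l * h'^* + l * '[gamma l, w.1.1].
  by rewrite kw addrK subrK.
by ring.
Qed.

Section Point.
Variable l : C.
Hypotheses (Dl : D l) (r1 : resolvent_set A1 l) (r2 : resolvent_set A2 l).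

Definition coupled_resolvent (y : K) : K :=
  let h := '[y.2, g l^*] in
  (resolvent A1 l y.1 + h *: gamma l,
   resolvent A2 l y.2 + ('[y.1, gamma l^*] + m l * h) *: g l).

Lemma coupledE x y : coupled l (x, y + l *: x) <-> x = coupled_resolvent y.
Proof.
have hE : coeff1 l (x, y + l *: x) = '[y.2, g l^*] by rewrite /coeff1 /= addrK.
have kE : coeff2 l (x, y + l *: x) = '[y.1, gamma l^*] + m l * '[y.2, g l^*].
  by rewrite /coeff2 hE /= addrK.
rewrite /coupled /= hE kE /coupled_resolvent.
move: ('[y.2, g l^*]) ('[y.1, gamma l^*] + m l * '[y.2, g l^*]) => h c.
have shift (V : pontryagin R) (u v z : V) a :
    u + l *: v - (l * a) *: z = u + l *: (v - a *: z).
  by rewrite scalerBr scalerA addrA.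
rewrite !shift; split=> [[B1 B2]|->].
  rewrite [x]surjective_pairing; congr (_, _).
    by rewrite (resolvent_uniq r1 (resolvent_mem y.1 r1) B1) subrK.
  by rewrite (resolvent_uniq r2 (resolvent_mem y.2 r2) B2) subrK.
by rewrite /= !addrK; split; exact: resolvent_mem.
Qed.

Lemma coupled_resolvent_set : resolvent_set (coupled l) l.
Proof.
split=> [y|].
  exists (coupled_resolvent y); split; first exact/coupledE.
  by move=> x /coupledE.
have [I1 [e1 [fe1 [M1 M10 bM1]]]] := resolvent_bounded r1.
have [I2 [e2 [fe2 [M2 M20 bM2]]]] := resolvent_bounded r2.
have [I [e fe]] := pontryaginP K.
have [N N0 bN] := majorant_sum_le fe1 fe2 e.
have [N' N'0 bN'] := majorant_le fe (sum_negbasis e1 e2).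
have [a a0 ba] := majorant_form_bound fe2 (g l^*).
have [b b0 bb] := majorant_form_bound fe1 (gamma l^*).
exists I, e; split=> //.
have [p pE] : exists p, p = majorant (pform K1) e1 (gamma l) by eexists.
have [q qE] : exists q, q = majorant (pform K2) e2 (g l) by eexists.
have p0 : 0 <= p by rewrite pE; exact: majorant_ge0.
have q0 : 0 <= q by rewrite qE; exact: majorant_ge0.
(* With s1, s2 the majorants of y.1, y.2, one has |h|^2 <= a s2 and |k|^2 <= b s1; each splitting of
   a sum costs a factor 2. *)
pose c1 := 2 * M1 + 2 * (a * p).
pose c2 := 2 * M2 + 2 * ((2 * b + 2 * (`|m l| ^+ 2 * a)) * q).
have c10 : 0 <= c1 by rewrite /c1 !(addr_ge0, mulr_ge0).
have c20 : 0 <= c2 by rewrite /c2 !(addr_ge0, mulr_ge0, exprn_ge0).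
exists (N * ((c1 + c2) * N')) => x y /coupledE ->.
apply: le_trans (bN _) _; rewrite -!mulrA; apply: ler_wpM2l => //.
have := bN' y; rewrite majorant_sum.
have := majorant_ge0 fe1 y.1; have := majorant_ge0 fe2 y.2.
have := ba y.2; have := bb y.1.
have := bM1 _ _ (resolvent_mem y.1 r1); have := bM2 _ _ (resolvent_mem y.2 r2).
rewrite /coupled_resolvent [(_, _).1]/= [(_, _).2]/=.
set h := '[y.2, _]; set k := '[y.1, _].
have [t1 t1E] : exists t, t = majorant (pform K1) e1 (resolvent A1 l y.1).
  by eexists.
have [t2 t2E] : exists t, t = majorant (pform K2) e2 (resolvent A2 l y.2).
  by eexists.
rewrite -t1E -t2E.
move: (majorant _ e1 y.1) (majorant _ e2 y.2) => s1 s2 ht2 ht1 hk hh s20 s10 hs.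
apply: (@le_trans _ _ ((c1 + c2) * (s1 + s2))); last first.
  by apply: ler_wpM2l => //; exact: addr_ge0.
rewrite mulrDl; apply: lerD.
  apply: le_trans (majorantD fe1 _ _) _; rewrite -t1E majorantZ -pE.
  have : 2 * t1 + 2 * (`|h| ^+ 2 * p) <= 2 * (M1 * s1) + 2 * (a * s2 * p).
    by apply: lerD; rewrite ler_pM2l// ler_wpM2r.
  move=> /le_trans; apply; rewrite -subr_ge0.
  have -> : c1 * (s1 + s2) - (2 * (M1 * s1) + 2 * (a * s2 * p)) =
    2 * (M1 * s2) + 2 * (a * p * s1) by rewrite /c1; ring.
  by rewrite !(addr_ge0, mulr_ge0).
apply: le_trans (majorantD fe2 _ _) _; rewrite -t2E majorantZ -qE.
have hc : `|k + m l * h| ^+ 2 <= 2 * (b * s1) + 2 * (`|m l| ^+ 2 * (a * s2)).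
  apply: le_trans (sqr_normD_le _ _) _; rewrite normrM exprMn.
  by apply: lerD; rewrite ler_pM2l// ler_wpM2l// exprn_ge0.
have : 2 * t2 + 2 * (`|k + m l * h| ^+ 2 * q) <=
    2 * (M2 * s2) + 2 * ((2 * (b * s1) + 2 * (`|m l| ^+ 2 * (a * s2))) * q).
  by apply: lerD; rewrite ler_pM2l// ler_wpM2r.
move=> /le_trans; apply; rewrite -subr_ge0.
have -> : c2 * (s1 + s2) -
   (2 * (M2 * s2) + 2 * ((2 * (b * s1) + 2 * (`|m l| ^+ 2 * (a * s2))) * q)) =
  2 * (M2 * s1) + 2 * ((2 * (b * s2) + 2 * (`|m l| ^+ 2 * (a * s1))) * q).
  by rewrite /c2; ring.
by rewrite !(addr_ge0, mulr_ge0, exprn_ge0).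
Qed.

End Point.

(** A symmetric relation with l and l' both regular is selfadjoint: for w in the adjoint, let v be
    the resolvent at l' of w.2 - l' w.1; then w.1 - v is orthogonal to the range at l, which is the
    whole space. *)
Lemma coupled_selfadjoint l : D l ->
  resolvent_set A1 l -> resolvent_set A2 l ->
  resolvent_set A1 l^* -> resolvent_set A2 l^* ->
  selfadjoint (coupled l).
Proof.
move=> Dl r1 r2 r1' r2'; apply/seteqP; split=> [x cx|w [_ _ Aw]].
  by split=> // y cy; exact: coupled_sym cy cx.
pose y : K := w.2 - l^* *: w.1; pose v := coupled_resolvent l^* y.
have cv : coupled l (v, y + l^* *: v).
  by apply: (coupled_sub (D_conj Dl) Dl); exact/(coupledE r1' r2').
have wE : w.2 = y + l^* *: w.1 by rewrite subrK.
suff wv : w.1 = v by rewrite [w]surjective_pairing wE wv.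
apply: pform_inj => z; rewrite pformC [RHS]pformC; congr (_^*).
pose x := coupled_resolvent l z.
have cx : coupled l (x, z + l *: x) by exact/(coupledE r1 r2).
have e1 : '[z + l *: x, w.1] = '[x, w.2] := Aw _ cx.
have e2 : '[z + l *: x, v] = '[x, y + l^* *: v] := coupled_sym Dl cx cv.
rewrite wE !pformE conjCK in e1; rewrite !pformE conjCK in e2.
by rewrite (addIr _ e1) (addIr _ e2).
Qed.

Variables (f : C -> C) (g' : C -> K2).
Hypothesis g'_increment : forall l k, D l -> D k ->
  A2 (g' l - g' k, l *: g' l - k *: g' k).
Hypothesis g'_pairing : forall l k, D l -> D k ->
  (l - k^*) * '[g' l, g k] = f l - f k^*.

Definition coupled_field l : K := (f l *: gamma l, (m l * f l) *: g l + g' l).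

(** The increment has [coeff1] equal to the increment of f and [coeff2] equal to that of m f; this
    accounts for the weight Q0 phi on e_1. *)
Lemma coupled_field_increment l k : D l -> D k -> coupled l
  (coupled_field l - coupled_field k, l *: coupled_field l - k *: coupled_field k).
Proof.
move=> Dl Dk; have Dl' := D_conj Dl.
have diff (V : pontryagin R) (u v : V) :
    l *: u - k *: v - l *: (u - v) = (l - k) *: v.
  by rewrite scalerBr scalerBl opprB addrC subrKA.
set x := (_, _).
have hE : coeff1 l x = f l - f k.
  rewrite /coeff1 [x.2]/= [x.1]/= diff pformZl [(coupled_field k).2]/= pformDl pformZl.
  have gg := g_isotropic Dk Dl'; have gp := g'_pairing Dk Dl'.
  rewrite !conjCK in gg gp.
  transitivity (- (m k * f k * ((k - l) * '[g k, g l^*])) -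
    (k - l) * '[g' k, g l^*]); first by ring.
  by rewrite gg gp mulr0 oppr0 add0r opprB.
have kE : coeff2 l x = m l * f l - m k * f k.
  rewrite /coeff2 hE [x.2]/= [x.1]/= diff pformZl [(coupled_field k).1]/= pformZl.
  have mm := m_identity Dk Dl'; rewrite conjCK m_conj// in mm.
  transitivity (- (f k * ((k - l) * '[gamma k, gamma l^*])) + m l * (f l - f k)).
    by ring.
  by rewrite -mm; ring.
have shift (V : pontryagin R) (u v : V) a b :
    a *: u - b *: v - (a - b) *: u = b *: (u - v).
  by rewrite scalerBr scalerBl opprB addrC subrKA.
have shift' (V : pontryagin R) (u v : V) a b :
    l *: (a *: u) - k *: (b *: v) - (l * (a - b)) *: u = b *: (l *: u - k *: v).
  rewrite mulrBr scalerBl scalerBr !scalerA [b * l]mulrC [b * k]mulrC.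
  by rewrite opprB addrC subrKA.
rewrite /coupled /= hE kE; split.
  by rewrite shift shift'; exact: selfadjointZ (gamma_increment Dl Dk).
have regroup (V : pontryagin R) (u u' v v' w : V) :
    u + u' - (v + v') - w = u - v - w + (u' - v').
  by rewrite opprD addrACA [LHS]addrAC.
rewrite regroup shift (scalerDr l) (scalerDr k) regroup shift'.
have := selfadjoint_comb sA2 (m k * f k) (g'_increment Dl Dk) (g_increment Dl Dk).
by congr (A2 (_, _)); rewrite /= addrC.
Qed.

End Coupling.

(** * Reproducing kernel spaces of rational functions *)

Section DualBases.
Variables (R : realType) (K : pontryagin R).
Local Notation C := (cplx R).
Variables (p : nat) (b b' : 'I_p -> K).
(** Finite dimension, encoded by a spanning family with coordinates given by the form. *)
Hypothesis bb' : forall f, f = \sum_i '[f, b' i] *: b i.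
Variable A : set (K * K).
Hypothesis sA : selfadjoint A.
Variable l1 : C.
Hypothesis r1 : resolvent_set A l1.
Local Notation T := (resolvent A l1).

Lemma resolvent_comb (a : C) u v : T (u + a *: v) = T u + a *: T v.
Proof.
apply: (resolvent_uniq r1 (resolvent_mem _ r1)).
have := selfadjoint_comb sA a (resolvent_mem u r1) (resolvent_mem v r1).
congr (A (_, _)) => /=.
by rewrite !scalerDr !scalerA (mulrC a) addrACA.
Qed.

Lemma resolvent0 : T 0 = 0.
Proof. by have := resolvent_comb (-1) 0 0; rewrite !scaleN1r !subrr. Qed.

Lemma resolvent_sum q (x : 'I_q -> C) (u : 'I_q -> K) :
  T (\sum_i x i *: u i) = \sum_i x i *: T (u i).
Proof.
elim/big_rec2: _ => [|i v w _ <-]; first exact: resolvent0.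
by rewrite addrC resolvent_comb addrC.
Qed.

Lemma resolvent_fixpoint l f g :
  A (f, g + l *: f) <-> f = T (g + (l - l1) *: f).
Proof.
have E : g + l *: f = g + (l - l1) *: f + l1 *: f.
  by rewrite -addrA -scalerDl subrK.
rewrite E; split=> [Af|fE]; first exact: (resolvent_uniq r1 Af (resolvent_mem _ r1)).
by have := resolvent_mem (g + (l - l1) *: f) r1; rewrite -fE.
Qed.

Let M : 'M[C]_p := \matrix_(i, j) '[T (b i), b' j].

Lemma resolvent_matrix f j :
  '[T f, b' j] = ((\row_i '[f, b' i]) *m M) 0 j.
Proof.
rewrite {1}[f]bb' resolvent_sum pform_suml mxE; apply: eq_bigr => i _.
by rewrite pformZl !mxE.
Qed.

(** If [b] is dependent, the sum of the x_i b_i need not have coordinates x; the chosen f has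
    coordinates t x M = x. *)
Lemma eigenvector_of_matrix (t : C) (x : 'rV_p) : x = t *: (x *m M) ->
  let f := t *: \sum_i x 0 i *: T (b i) in
  f = t *: T f /\ forall j, '[f, b' j] = x 0 j.
Proof.
move=> xE f; have fx j : '[f, b' j] = x 0 j.
  rewrite [in RHS]xE /f pformZl pform_suml !mxE; congr (_ * _).
  by apply: eq_bigr => i _; rewrite pformZl !mxE.
split=> //; rewrite {1}/f; congr (_ *: _).
rewrite [in RHS](bb' f) resolvent_sum; apply: eq_bigr => i _.
by rewrite fx.
Qed.

(** In coordinates, A - l becomes U = 1 - t M, and an injective square matrix is invertible. The
    solution is T g plus a finite-rank term in T g, hence bounded. *)
Lemma regular_of_injective l : (forall f, A (f, l *: f) -> f = 0) ->
  resolvent_set A l.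
Proof.
move=> inj; set t := l - l1.
have inj' f : f = t *: T f -> f = 0.
  move=> fE; apply: inj; rewrite -[l *: f]add0r.
  apply/resolvent_fixpoint; rewrite -/t.
  by rewrite resolvent_comb resolvent0 add0r.
pose U := 1%:M - t *: M.
have Uu : U \in unitmx.
  rewrite -row_free_unit -kermx_eq0; apply/eqP/row_matrixP => i.
  rewrite row0; set x := row i _.
  have xU : x *m U = 0 by rewrite /x -row_mul mulmx_ker row0.
  have xE : x = t *: (x *m M).
    move: xU; rewrite mulmxBr mulmx1 -scalemxAr => /eqP.
    by rewrite subr_eq0 => /eqP.
  have [/inj' f0 fx] := eigenvector_of_matrix xE.
  by apply/rowP => j; rewrite -fx f0 pform0l mxE.
have solve g (x : 'rV_p) : x *m U = \row_i '[T g, b' i] ->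
    A (T g + t *: \sum_i x 0 i *: T (b i),
       g + l *: (T g + t *: \sum_i x 0 i *: T (b i))).
  move=> xU; set f := T g + _; apply/resolvent_fixpoint.
  rewrite resolvent_comb -/t {1}/f; congr (_ + _ *: _).
  have fx j : '[f, b' j] = x 0 j.
    have -> : x 0 j = (x *m U + t *: (x *m M)) 0 j.
      by rewrite mulmxBr mulmx1 -scalemxAr subrK.
    rewrite /f pformDl pformZl pform_suml xU !mxE; congr (_ + _ * _).
    by apply: eq_bigr => i _; rewrite pformZl !mxE.
  rewrite [in RHS](bb' f) resolvent_sum; apply: eq_bigr => i _.
  by rewrite fx.
have solve' g := solve g _ (mulmxKV Uu (\row_i '[T g, b' i])).
have uniq g f f' : A (f, g + l *: f) -> A (f', g + l *: f') -> f = f'.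
  move=> Af Af'; apply/eqP; rewrite -subr_eq0; apply/eqP/inj.
  have := selfadjointB sA Af Af'; congr (A (_, _)) => /=.
  by rewrite opprD addrACA subrr add0r scalerBr.
have [I [e [fe [N N0 bN]]]] := resolvent_bounded r1.
split=> [g|].
  by eexists; split; [exact: solve'|move=> f; apply: uniq; exact: solve'].
exists I, e; split=> //.
(* The inverse of U is moved onto the functionals; it is conjugated because the form is antilinear
   in its second argument. *)
pose d' j := \sum_i (invmx U i j)^* *: b' i.
have [N' N'0 bN'] := majorant_bounded_finite_rank fe d' (fun j => T (b j)).
exists (2 * N + 2 * (`|t| ^+ 2 * (N' * N))) => f g /uniq-/(_ _ (solve' g))->.
have TN := bN _ _ (resolvent_mem g r1).
apply: le_trans (majorantD fe _ _) _.
have -> : (2 * N + 2 * (`|t| ^+ 2 * (N' * N))) * majorant (pform K) e g =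
    2 * (N * majorant (pform K) e g) +
    2 * (`|t| ^+ 2 * (N' * (N * majorant (pform K) e g))) by ring.
apply: lerD; rewrite ler_pM2l// majorantZ; apply: ler_wpM2l.
  by rewrite exprn_ge0.
apply: (@le_trans _ _ (N' * majorant (pform K) e (T g))); last exact: ler_wpM2l.
have -> : \sum_i ((\row_i '[T g, b' i]) *m invmx U) 0 i *: T (b i) =
    \sum_i '[T g, d' i] *: T (b i).
  apply: eq_bigr => i _; congr (_ *: _); rewrite mxE pform_sumr.
  by apply: eq_bigr => j _; rewrite pformZr conjCK mxE mulrC.
exact: bN'.
Qed.

(** An eigenvector at l' is orthogonal to the range of A - l, which is the whole space. *)
Lemma resolvent_set_conj l : resolvent_set A l -> resolvent_set A l^*.
Proof.
move=> rl; apply: regular_of_injective => f Af; apply: pform_nondegenerate => u.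
have E : '[u + l *: resolvent A l u, f] = '[resolvent A l u, l^* *: f] :=
  selfadjoint_sym sA (resolvent_mem u rl) Af.
rewrite pformC; suff -> : '[u, f] = 0 by rewrite rmorph0.
move: E; rewrite pformDl pformZl pformZr conjCK => E.
by apply: (addIr (l * '[resolvent A l u, f])); rewrite E add0r.
Qed.

Lemma resolvent_set_cofinite : exists s : seq C,
  forall l, l \notin s -> resolvent_set A l.
Proof.
have [r rE] := closed_field_poly_normal (char_poly M).
(* An eigenvector of [A] at l is one of T at (l - l1)^-1. A root z = 0 contributes l1, as 0^-1 = 0,
   and only enlarges the list. *)
exists (map (fun z => l1 + z^-1) r) => l ls.
apply: regular_of_injective => f Af; apply/eqP/negPn/negP => f0.
move/negP: ls; apply; apply/mapP; exists (l - l1)^-1; last first.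
  by rewrite invrK addrC subrK.
have : root (char_poly M) (l - l1)^-1.
  rewrite -eigenvalue_root_char; apply/eigenvalueP.
  have fE : f = (l - l1) *: T f.
    have := (resolvent_fixpoint l f 0).1; rewrite !add0r => /(_ Af).
    by have := resolvent_comb (l - l1) 0 f; rewrite resolvent0 !add0r => ->.
  have ll : l - l1 != 0.
    by apply: contra_neq f0 => ll; rewrite fE ll scale0r.
  exists (\row_i '[f, b' i]); last first.
    apply: contra_neq f0 => x0; rewrite [f]bb' big1// => i _.
    by move/rowP/(_ i): x0; rewrite !mxE => ->; rewrite scale0r.
  apply/rowP => j; rewrite -resolvent_matrix !mxE {2}fE pformZl.
  by rewrite mulrA mulVf// mul1r.
rewrite rE (monicP (char_poly_monic _)) scale1r root_prod_XsubC.
exact.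
Qed.

End DualBases.

Section FiniteRankKernel.
Variables (R : realType) (K : pontryagin R) (n : nat).
Local Notation C := (cplx R).
Variables (D : set C) (N : C -> C -> 'M[C]_n) (ev : K -> C -> 'cV[C]_n).
Hypothesis rk : rk_space D N ev.

Definition kernel_element (k : K) := exists w c, [/\ D w,
  forall z, D z -> ev k z = N z w *m c &
  forall f, '[f, k] = (adjmx c *m ev f w) 0 0].

Lemma kernel_total f : (forall k, kernel_element k -> '[f, k] = 0) -> f = 0.
Proof.
move=> fk; have [_ inj ex] := rk; apply: inj => w Dw; apply/colP => i.
have [k kE kf] := ex w (delta_mx i 0) Dw.
have := fk k (ex_intro _ w (ex_intro _ _ (And3 Dw kE kf))); rewrite kf !mxE.
rewrite (bigD1 i)//= big1 => [|j ji].
  by rewrite !mxE !eqxx rmorph1 mul1r addr0.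
by rewrite !mxE (negbTE ji) rmorph0 mul0r.
Qed.

Lemma ev_sum p (x : 'I_p -> C) (u : 'I_p -> K) z :
  ev (\sum_i x i *: u i) z = \sum_i x i *: ev (u i) z.
Proof.
have [lin _ _] := rk; have ev0 : ev 0 z = 0.
  by have := lin z (-1) 0 0; rewrite !scaleN1r addNr => ->; rewrite addNr.
elim/big_rec2: _ => [//|i v w _ <-]; exact: lin.
Qed.

Variables (d : nat) (F : 'I_d -> C -> 'cV[C]_n).
Hypothesis finite_rank : forall w c, D w -> exists a : 'I_d -> C,
  forall z, D z -> N z w *m c = \sum_i a i *: F i z.

Let independent p (b : 'I_p -> K) :=
  forall x : 'rV[C]_p, \sum_i x 0 i *: b i = 0 -> x = 0.

(** Expanding p > d kernel functions in the d functions [F] gives a linear relation between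
    coefficient rows, hence between elements since evaluation is injective. *)
Lemma kernel_independent_size p (b : 'I_p -> K) :
  (forall i, kernel_element (b i)) -> independent b -> (p <= d)%N.
Proof.
move=> kb ib; rewrite leqNgt; apply/negP => dp.
have /choice[a aE] : forall i, exists a : 'I_d -> C,
    forall z, D z -> ev (b i) z = \sum_j a j *: F j z.
  move=> i; have [w [c [Dw kE _]]] := kb i.
  by have [a aE] := finite_rank c Dw; exists a => z Dz; rewrite kE// aE.
pose M : 'M[C]_(p, d) := \matrix_(i, j) a i j.
have [x xM x0] : exists2 x : 'rV_p, x *m M = 0 & x != 0.
  have : kermx M != 0.
    rewrite kermx_eq0 /row_free neq_ltn; apply/orP; left.
    by apply: leq_ltn_trans dp; exact: rank_leq_col.
  move=> /rowV0Pn[x /sub_kermxP xM x0]; by exists x.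
move/eqP: x0; apply; apply: ib; have [_ inj _] := rk; apply: inj => z Dz.
rewrite ev_sum.
under eq_bigr => i _ do rewrite (aE i z Dz) scaler_sumr.
rewrite exchange_big /= big1// => j _.
under eq_bigr do rewrite scalerA.
rewrite -scaler_suml; have := congr1 (fun y : 'rV_d => y 0 j) xM; rewrite !mxE.
by under eq_bigr do rewrite mxE; move=> ->; rewrite scale0r.
Qed.

(** A maximal independent family of kernel elements spans all of them, so only 0 is orthogonal to
    it. Hence its Gram matrix is invertible, and the inverse yields the dual family. *)
Lemma kernel_dual_bases : exists p (b b' : 'I_p -> K),
  forall f, f = \sum_i '[f, b' i] *: b i.
Proof.
pose Q p := `[< exists b : 'I_p -> K,
  (forall i, kernel_element (b i)) /\ independent b >].
have Q0 : exists p, Q p.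
  exists 0; apply/asboolP; exists (fun=> 0); split; first by case.
  by move=> x _; apply/rowP; case.
have Qd p : Q p -> (p <= d)%N.
  by move=> /asboolP[b [kb ib]]; exact: kernel_independent_size kb ib.
case: (ex_maxnP Q0 Qd) => p /asboolP[b [kb ib]] pmax.
have span k : kernel_element k -> exists x : 'I_p -> C, k = \sum_i x i *: b i.
  move=> kk; pose e (i : 'I_p.+1) := oapp b k (unlift ord0 i).
  have ke i : kernel_element (e i) by rewrite /e; case: unliftP => [j|] _ /=.
  have ie : ~ independent e.
    move=> ie; have /pmax : Q p.+1 by apply/asboolP; exists e.
    by rewrite ltnn.
  have [x /not_implyP[]] := (existsNP _).2 ie; rewrite big_ord_recl /e unlift_none /=.
  under eq_bigr do rewrite liftK /=.
  move=> x0; have [x00|x00] := eqVneq (x 0 ord0) 0.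
    case; apply/rowP => j; rewrite mxE.
    have : \row_i x 0 (lift ord0 i) = 0.
      apply: ib; move: x0; rewrite x00 scale0r add0r => x0.
      by rewrite -[RHS]x0; apply: eq_bigr => i _; rewrite mxE.
    case: (unliftP ord0 j) => [i ->|->//] /rowP/(_ i).
    by rewrite !mxE.
  move=> _; exists (fun i => - ((x 0 ord0)^-1 * x 0 (lift ord0 i))).
  have := congr1 ( *:%R (x 0 ord0)^-1) x0.
  rewrite scalerDr scalerA mulVf// scale1r scaler0 => /eqP.
  rewrite addr_eq0 => /eqP ->; rewrite scaler_sumr -sumrN.
  by apply: eq_bigr => i _; rewrite scalerA scaleNr.
have perp f : (forall i, '[f, b i] = 0) -> f = 0.
  move=> fb; apply: kernel_total => k /span[x ->].
  by rewrite pform_sumr big1// => i _; rewrite pformZr fb mulr0.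
pose G : 'M[C]_p := \matrix_(i, j) '[b i, b j].
have Gu : G \in unitmx.
  rewrite -row_free_unit -kermx_eq0; apply/eqP/row_matrixP => i.
  rewrite row0; apply: ib; apply: perp => j; rewrite pform_suml.
  have xG : (row i (kermx G) *m G) 0 j = 0.
    by rewrite -row_mul mulmx_ker row0 mxE.
  rewrite -[RHS]xG [RHS]mxE; apply: eq_bigr => k _.
  by rewrite pformZl [X in _ = _ * X]mxE.
exists p, b, (fun i => \sum_j (invmx G j i)^* *: b j) => f.
apply/eqP; rewrite -subr_eq0; apply/eqP; apply: perp => j.
pose y : 'rV[C]_p := \row_i '[f, b i].
have yE i : '[f, \sum_j (invmx G j i)^* *: b j] = (y *m invmx G) 0 i.
  rewrite pform_sumr mxE; apply: eq_bigr => k _.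
  by rewrite pformZr conjCK mxE mulrC.
rewrite pformBl pform_suml; apply/eqP; rewrite subr_eq0; apply/eqP.
have <- : y 0 j = '[f, b j] by rewrite mxE.
rewrite -[y in LHS](mulmxKV Gu) [LHS]mxE; apply: eq_bigr => i _.
by rewrite pformZl yE [X in _ * X = _]mxE.
Qed.

End FiniteRankKernel.

Section DividedDifference.
Variable R : realType.
Local Notation C := (cplx R).
Implicit Types p q : {poly C}.

Definition divided_difference (f : C -> C) (z y : C) :=
  if z == y then derive1 f y else (f z - f y) / (z - y).

Lemma is_derive_horner p y : is_derive (y : C) 1 (horner p) p^`().[y].
Proof.
elim/poly_ind: p => [|p c IHp].
  have -> : horner (0 : {poly C}) = cst 0 by apply/funext => x; rewrite horner0.
  by rewrite deriv0 horner0; exact: is_derive_cst.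
have -> : horner (p * 'X + c%:P) = horner p * id + cst c.
  by apply/funext => x; rewrite !hornerE.
have := is_deriveD (is_deriveM IHp (is_derive_id y 1)) (is_derive_cst c y 1).
congr is_derive; rewrite derivD derivM derivX derivC !hornerE /GRing.scale /=.
by rewrite mulr1 addrC [y * _]mulrC.
Qed.

Lemma derive1_polyfrac p q y : q.[y] != 0 ->
  derive1 (fun x => p.[x] / q.[x]) y =
  (p^`().[y] * q.[y] - p.[y] * q^`().[y]) / q.[y] ^+ 2.
Proof.
move=> qy; have dp := is_derive_horner p y; have dq := is_derive_horner q y.
have dV : is_derive (y : C) 1 (fun x => (q.[x])^-1)
    (- q.[y] ^- 2 *: q^`().[y]) .
  by apply: DeriveDef; [exact: derivableV|rewrite deriveV// derive_val].
have -> : (fun x => p.[x] / q.[x]) = horner p * (fun x => (q.[x])^-1) by [].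
rewrite derive1E (@derive_val _ _ _ _ _ _ _ (is_deriveM dp dV)).
by rewrite /GRing.scale /=; field.
Qed.

(** The polynomial q(y) p - p(y) q vanishes at y; if S is its quotient by X - y, the divided
    difference is S(z) / (q(y) q(z)), also at z = y. Only the coefficients of S depend on y. *)
Lemma divided_difference_finite_rank p q d : (size p <= d)%N -> (size q <= d)%N ->
  forall y, q.[y] != 0 -> exists a : 'I_d -> C, forall z, q.[z] != 0 ->
    divided_difference (fun x => p.[x] / q.[x]) z y =
    \sum_i a i * (z ^+ i / q.[z]).
Proof.
move=> pd qd y qy; pose P := q.[y] *: p - p.[y] *: q.
have Py : root P y by rewrite /root !hornerE mulrC subrr.
have [S PE] := factor_theorem P y Py.
have Sd : (size S <= d)%N.
  have [->|S0] := eqVneq S 0; first by rewrite size_poly0.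
  have : (size P <= d)%N.
    rewrite (leq_trans (size_polyD _ _))// geq_max size_polyN.
    by rewrite !(leq_trans (size_scale_leq _ _)).
  by rewrite PE size_Mmonic ?monicXsubC// size_XsubC addn2; exact: ltnW.
exists (fun i => S`_i / q.[y]) => z qz.
have -> : \sum_(i < d) S`_i / q.[y] * (z ^+ i / q.[z]) = S.[z] / (q.[y] * q.[z]).
  rewrite (horner_coef_wide _ Sd) mulr_suml; apply: eq_bigr => i _.
  by rewrite invfM; ring.
rewrite /divided_difference; case: eqVneq => [->|zy].
  rewrite derive1_polyfrac//.
  have -> : S.[y] = P^`().[y].
    by rewrite PE derivM derivXsubC !hornerE subrr mulr0 add0r.
  by rewrite /P derivB !derivZ !hornerE; field.
have zy0 : z - y != 0 by rewrite subr_eq0.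
have SE : S.[z] = (q.[y] * p.[z] - p.[y] * q.[z]) / (z - y).
  have <- : P.[z] = q.[y] * p.[z] - p.[y] * q.[z] by rewrite /P !hornerE.
  by apply: (mulIf zy0); rewrite divfK// PE !hornerE.
rewrite SE; field.
by rewrite qy qz zy0.
Qed.

End DividedDifference.

Section PhiKernel.
Variables (R : realType) (phi : ratfun R).
Local Notation C := (cplx R).
Let conjp (p : {poly C}) := map_poly (@conjC C) p.

Lemma horner_conj (p : {poly C}) z : (p.[z^*])^* = (conjp p).[z].
Proof. by rewrite -{2}(conjCK z) horner_map. Qed.

Lemma sharp_ratfun :
  sharp phi = fun z => (conjp (rnum phi)).[z] / (conjp (rden phi)).[z].
Proof.
apply/funext => z; rewrite -!horner_conj /sharp /reval.
by rewrite rmorphM fmorphV.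
Qed.

Lemma rdom_neq0 z : rdom phi z -> (rden phi).[z] != 0.
Proof. by []. Qed.

Lemma rdom_conj_neq0 z : rdom phi z^* -> (conjp (rden phi)).[z] != 0.
Proof. by move=> h; rewrite -horner_conj fmorph_eq0. Qed.

Lemma Phi_conj_dom z : Phi_dom phi z -> Phi_dom phi z^*.
Proof. by move=> [h h']; split=> //; rewrite conjCK. Qed.

(** The adjoint of Phi(w) is Phi at the conjugate point, since conjugate transposition exchanges phi
    and phi^sharp. *)
Lemma Phi_kernelE z w : mxnevkernel (Phi_mx phi) z w = \matrix_(i, j)
  if i == j then 0 else
  divided_difference (if i == 0 then phi : C -> C else sharp phi) z w^*.
Proof.
have E (i j : 'I_2) : (fun x => Phi_mx phi x i j) =
    (if i == j then fun=> 0 else if i == 0 then phi : C -> C else sharp phi).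
  apply/funext => x; rewrite mxE; case: (i == j) => //; by case: (i == 0).
have neqE (i j : 'I_2) : i != j -> (j == 0) = (i != 0).
  by case: i j => [[|[|//]] ?] [[|[|//]] ?].
apply/matrixP => i j; rewrite mxE /mxnevkernel /divided_difference.
case: eqVneq => [->|zw]; rewrite ?mxE.
  rewrite E; case: (i == j) => //; exact: derive1_cst.
rewrite [LHS]mulrC (eq_sym j i).
case: eqVneq => [_|/neqE ->]; first by rewrite rmorph0 subrr mul0r.
by case: (i == 0) => /=; rewrite /sharp conjCK.
Qed.

Lemma Phi_kernel_finite_rank : exists d (F : 'I_d -> C -> 'cV[C]_2),
  forall w c, Phi_dom phi w -> exists a : 'I_d -> C, forall z, Phi_dom phi z ->
    mxnevkernel (Phi_mx phi) z w *m c = \sum_i a i *: F i z.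
Proof.
pose p := rnum phi; pose q := rden phi.
pose d := maxn (size p) (size q).
pose F (i : 'I_(d + d)) (z : C) : 'cV[C]_2 := match fintype.split i with
  | inl j => (z ^+ j / q.[z]) *: delta_mx 0 0
  | inr j => (z ^+ j / (conjp q).[z]) *: delta_mx 1 0 end.
exists (d + d)%N, F => w c [Dw Dw'].
have [a aE] := divided_difference_finite_rank (leq_maxl (size p) (size q))
  (leq_maxr (size p) (size q)) Dw'.
have [|||b bE] := @divided_difference_finite_rank _ (conjp p) (conjp q) d _ _ w^*.
- by rewrite size_map_poly leq_maxl.
- by rewrite size_map_poly leq_maxr.
- by rewrite rdom_conj_neq0// conjCK.
(* Phi is off-diagonal: the first row of the kernel acts on the second coordinate of c, the second
   row on the first. *)
exists (fun i => match fintype.split i with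
  | inl j => a j * c 1 0 | inr j => b j * c 0 0 end) => z [Dz Dz'].
have sumE (x : 'I_d -> C) (t k : C) (v : 'cV[C]_2) :
    \sum_(i < d) (x i * k) *: ((z ^+ i / t) *: v) =
    (\sum_(i < d) x i * (z ^+ i / t) * k) *: v.
  rewrite scaler_suml; apply: eq_bigr => i _; rewrite scalerA; congr (_ *: _).
  by rewrite mulrAC.
rewrite big_split_ord /=.
under eq_bigr => i _ do rewrite /F -[lshift d i]/(unsplit (inl i)) unsplitK.
under [X in _ = _ + X]eq_bigr => i _ do
  rewrite /F -[rshift d i]/(unsplit (inr i)) unsplitK.
rewrite !sumE -!mulr_suml -aE// -bE ?rdom_conj_neq0//.
rewrite -[X in divided_difference X z w^* * c 0 0]sharp_ratfun Phi_kernelE.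
apply/colP => i; rewrite !mxE !big_ord_recl big_ord0 addr0 !mxE.
case: i => [[|[|//]] ?]; rewrite /= ?mul0r ?add0r ?mulr0 ?mulr1.
  by rewrite addr0; congr (_ * c _ _); exact: val_inj.
by rewrite add0r addr0; have -> : ord0 = 0 :> 'I_2 by exact: val_inj.
Qed.

End PhiKernel.

Lemma nonroot_nonreal (R : realType) (p : {poly cplx R}) : p != 0 ->
  exists2 l : cplx R, nonreal l & ~~ root p l.
Proof.
move=> p0; apply: contrapT => h.
(* These are size p distinct nonreal points, one more than p has roots at most. *)
pose s := [seq 'i * n.+1%:R : cplx R | n <- iota 0 (size p)].
have : (size s < size p)%N.
  apply: max_poly_roots => //; last first.
    rewrite map_inj_uniq ?iota_uniq// => a b /(mulfI (neq0Ci _))/eqP.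
    by rewrite eqr_nat eqSS => /eqP.
  apply/allP => _ /mapP[n _ ->]; apply/negPn/negP => rn; apply: h.
  exists ('i * n.+1%:R) => //; rewrite /nonreal /=.
  by rewrite -['i * _]add0r Im_rect ?pnatr_eq0 ?real0 ?ger0_real ?ler0n.
by rewrite size_map size_iota ltnn.
Qed.

(** * The realization of Q *)

Section Factorization.
Variable R : realType.
Local Notation C := (cplx R).

Lemma nbhs_nonreal (l : C) (U : set C) : nbhs l U -> exists2 z, nonreal z & U z.
Proof.
have [l0|ln] := eqVneq ('Im l) 0; last first.
  by move=> /nbhs_singleton Ul; exists l.
move=> /nbhs_ballP[e /= e0 eU]; exists (l + 'i * (e / 2)).
  have er : e \is Num.real by rewrite ger0_real// ltW.
  have -> : l = 'Re l by rewrite {1}[l]Crect l0 mulr0 addr0.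
  rewrite /nonreal /= Im_rect ?Creal_Re// ?mulf_neq0 ?invr_eq0 ?gt_eqF//.
  by rewrite realM// realV realn.
apply: eU; rewrite -ball_normE /= opprD addrA subrr add0r normrN normrM.
rewrite normCi mul1r ger0_norm ?divr_ge0 ?ltW//.
by rewrite gtr_pMr// invf_lt1// ltr1n.
Qed.

Lemma derivable_ratfun (p q : {poly C}) (y : C) : q.[y] != 0 ->
  derivable (fun x => p.[x] / q.[x]) y 1.
Proof.
move=> qy; have dp := @ex_derive _ _ _ _ _ _ _ (is_derive_horner p y).
have dq := @ex_derive _ _ _ _ _ _ _ (is_derive_horner q y).
have dV : derivable (fun x => (q.[x])^-1) y 1 by exact: derivableV.
have -> : (fun x => p.[x] / q.[x]) = horner p * (fun x => (q.[x])^-1) by [].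
exact: derivableM dp dV.
Qed.

(** The factorization is given at nonreal points, whereas l may be real: both sides are continuous
    at l and agree at nonreal points arbitrarily close to it. *)
Lemma canonical_factorization_at Q (phi : ratfun R) Q0 (l : C) :
  canonical_factorization Q phi Q0 ->
  hol Q l -> hol Q0 l -> Phi_dom phi l -> Q l = phi l * sharp phi l * Q0 l.
Proof.
move=> [_ _ QE] hQ hQ0 [dl dl']; apply/eqP; rewrite -subr_eq0.
pose f := (phi : C -> C) * sharp phi * Q0.
have df : derivable (Q - f) l 1.
  apply: derivableB; first exact: nbhs_singleton hQ.
  apply: derivableM; last exact: nbhs_singleton hQ0.
  apply: derivableM; first exact: derivable_ratfun.
  by rewrite sharp_ratfun; apply: derivable_ratfun; exact: rdom_conj_neq0.
have cf : {for l, continuous (Q - f)}.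
  by apply/differentiable_continuous/derivable1_diffP.
apply/negPn/negP => fn0.
have n1 : \forall z \near l, (Q - f) z != 0 by exact: cvgr_neq0 cf fn0.
have n2 : \forall z \near l, hol Q z by exact: nbhs_interior hQ.
have cont_horner (p : {poly C}) (y : C) : p.[y] != 0 -> \forall z \near y, p.[z] != 0.
  move=> py; have dp := @ex_derive _ _ _ _ _ _ _ (is_derive_horner p y).
  have cp : {for y, continuous (horner p)}.
    exact/differentiable_continuous/derivable1_diffP.
  exact: cvgr_neq0 cp py.
have n3 := cont_horner _ _ (rdom_neq0 dl).
have n4 := cont_horner _ _ (rdom_conj_neq0 dl').
have [z zr [[[Qf hz] rz] rz']] :=
  nbhs_nonreal (filterI (filterI (filterI n1 n2) n3) n4).
move/eqP: Qf; apply; apply/eqP; rewrite subr_eq0; apply/eqP; apply: QE => //.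
by rewrite /rdom /= /root -horner_conj fmorph_eq0 in rz' *.
Qed.

End Factorization.

Section CoupledRealization.
Variable R : realType.
Local Notation C := (cplx R).
Variables (Q : C -> C) (phi : ratfun R) (Q0 : C -> C).
Variables (H : hilbert R) (A : set (H * H)) (xi : option R).
Variables (rig : rigging (base A xi)) (omega : rg_neg rig) (eta : R).
Variable gamma0 : C -> H.
Variables (K : pontryagin R) (ev : K -> C -> 'cV[C]_2).
Variables (APhi : set (K * K)) (gammaPhi : C -> 'cV[C]_2 -> K).
Hypothesis factQ : canonical_factorization Q phi Q0.
Hypothesis sA : selfadjoint A.
Hypothesis realQ0 : model_realizes omega eta gamma0 Q0.
Hypothesis rkPhi : rk_space (Phi_dom phi) (mxnevkernel (Phi_mx phi)) ev.
Hypothesis realPhi :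
  realizes (Phi_dom phi) (Phi_mx phi) setT APhi gammaPhi.

Local Notation D := (coupled_dom phi Q0 A APhi).
Local Notation e i := (delta_mx (i : 'I_2) (0 : 'I_1) : 'cV[C]_2).
Local Notation g := (fun l => gammaPhi l (e 0)).
Local Notation g' := (fun l => gammaPhi l (e 1)).

Lemma Phi_selfadjoint : selfadjoint APhi. Proof. by case: realPhi. Qed.

Lemma Phi_resolvent_set_conj l : resolvent_set APhi l -> resolvent_set APhi l^*.
Proof.
have [d [F FP]] := Phi_kernel_finite_rank phi.
have [p [b [b' bb']]] := kernel_dual_bases rkPhi FP.
have [_ [l1 r1] _ _ _] := realPhi.
by apply: (resolvent_set_conj bb' Phi_selfadjoint r1).
Qed.

Lemma coupled_dom_conj l : D l -> D l^*.
Proof.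
move=> [[[rA rP] hQ] dP]; split; last exact: Phi_conj_dom.
split; first by split; [exact: hilbert_resolvent_conj|exact: Phi_resolvent_set_conj].
have [l0|ln] := eqVneq ('Im l) 0.
  suff -> : l^* = l by [].
  by apply/eqP; rewrite -CrealE; apply/Creal_ImP.
by have [[hol0 _ _] _ _] := factQ; apply: hol0; rewrite /nonreal /= Im_conj oppr_eq0.
Qed.

Lemma coupled_dom_nonempty : exists l, D l.
Proof.
have [d [F FP]] := Phi_kernel_finite_rank phi.
have [p [b [b' bb']]] := kernel_dual_bases rkPhi FP.
have [_ [l1 r1] _ _ _] := realPhi.
have [s sP] := resolvent_set_cofinite bb' Phi_selfadjoint r1.
(* The roots to avoid are the exceptional points of [APhi] and the poles of phi and phi^sharp;
   nonreal points already suit [A] and [Q0]. *)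
pose P := (\prod_(z <- s) ('X - z%:P)) * (rden phi * map_poly (@conjC C) (rden phi)).
have P0 : P != 0.
  rewrite !mulf_neq0 ?map_poly_eq0 ?rden_neq0// prodf_seq_neq0.
  by apply/allP => z _; rewrite polyXsubC_eq0.
have [l ln] := nonroot_nonreal P0.
rewrite !rootM root_prod_XsubC !negb_or => /and3P[/sP rP dl dl'].
exists l; split; last first.
  by split=> //; move: dl'; rewrite /rdom /= /root -horner_conj fmorph_eq0.
split; first by split=> //; exact: nonreal_resolvent.
by have [[hol0 _ _] _ _] := factQ; exact: hol0.
Qed.

Lemma gamma0_increment l k : D l -> D k ->
  A (gamma0 l - gamma0 k, l *: gamma0 l - k *: gamma0 k).
Proof.
move=> [[[rl _] _] _] [[[rk _] _] _].
exact: model_gamma_resolvent realQ0 _ _ _ _.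
Qed.

Lemma Q0_identity l k : D l -> D k ->
  Q0 l - (Q0 k)^* = (l - k^*) * '[gamma0 l, gamma0 k].
Proof.
move=> [[[rl _] hl] _] [[[rk _] hk] _].
exact: model_weyl_identity realQ0 _ _ _ _ _ _.
Qed.

Lemma gammaPhi_increment i l k : D l -> D k ->
  APhi (gammaPhi l (e i) - gammaPhi k (e i),
    l *: gammaPhi l (e i) - k *: gammaPhi k (e i)).
Proof.
move=> [[[_ rl] _] _] [[[_ rk] _] _]; have [_ _ _ inc _] := realPhi.
by apply/(resolvent_increment Phi_selfadjoint _ _ _ rl); exact: inc.
Qed.

Lemma gammaPhi_pairing i j l k : D l -> D k ->
  (l - k^*) * '[gammaPhi l (e j), gammaPhi k (e i)] =
  Phi_mx phi l i j - (Phi_mx phi k j i)^*.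
Proof.
move=> [[[_ rl] _] dl] [[[_ rk] _] dk]; have [_ _ _ _ gram] := realPhi.
have /matrixP/(_ i j) := gram l k (conj rl I) (conj rk I) dl dk.
by rewrite !mxE => ->.
Qed.

Lemma gammaPhi_isotropic l k : D l -> D k -> (l - k^*) * '[g l, g k] = 0.
Proof. by move=> Dl Dk; rewrite gammaPhi_pairing// !mxE rmorph0 subrr. Qed.

Lemma gammaPhi_off_diagonal l k : D l -> D k ->
  (l - k^*) * '[g' l, g k] = phi l - phi k^*.
Proof. by move=> Dl Dk; rewrite gammaPhi_pairing// !mxE /= /sharp conjCK. Qed.

Lemma coupled_gammaE l : D l ->
  coupled_gamma phi Q0 gamma0 gammaPhi l = coupled_field gamma0 Q0 g phi g' l.
Proof.
move=> [[[_ rl] _] _]; have [_ _ lin _ _] := realPhi.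
rewrite /coupled_gamma /coupled_field; congr (_, _).
rewrite -(lin l (conj rl I)); congr gammaPhi.
apply/colP => i; rewrite !mxE.
by case: i => [[|[|//]] ?]; rewrite /= ?mulr1 ?mulr0 ?addr0 ?add0r.
Qed.

Lemma coupled_weyl_identity l k : D l -> D k -> hol Q l -> hol Q k ->
  Q l - (Q k)^* = (l - k^*) * '[coupled_gamma phi Q0 gamma0 gammaPhi l,
                                coupled_gamma phi Q0 gamma0 gammaPhi k].
Proof.
move=> Dl Dk hl hk; rewrite !coupled_gammaE// psum_formE.
have [[_ hl0] dl] := Dl; have [[_ hk0] dk] := Dk.
rewrite (canonical_factorization_at factQ hl hl0 dl).
rewrite (canonical_factorization_at factQ hk hk0 dk).
rewrite /coupled_field [(_, _).1]/= [(_, _).2]/= [(_, _).1]/= [(_, _).2]/=.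
have p00 := gammaPhi_isotropic Dl Dk.
have p01 : (l - k^*) * '[g' l, g k] = phi l - (sharp phi k)^*.
  by rewrite gammaPhi_pairing// !mxE.
have p10 : (l - k^*) * '[g l, g' k] = sharp phi l - (phi k)^*.
  by rewrite gammaPhi_pairing// !mxE.
have p11 : (l - k^*) * '[g' l, g' k] = 0.
  by rewrite gammaPhi_pairing// !mxE rmorph0 subrr.
have q00 := Q0_identity Dl Dk.
move: (reval phi k) (reval phi l) (sharp phi k) (sharp phi l) p01 p10.
move=> u v u' v' p01 p10.
rewrite !pformDl !pformDr !pformZl !pformZr !rmorphM.
set a := (l - k^*) in p00 p01 p10 p11 q00 *.
transitivity (v * u^* * (a * '[gamma0 l, gamma0 k]) +
  (Q0 l * v * ((Q0 k)^* * u^*) * (a * '[g l, g k]) +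
   Q0 l * v * (a * '[g l, g' k]) +
   (Q0 k)^* * u^* * (a * '[g' l, g k]) + a * '[g' l, g' k])).
  by rewrite p00 p01 p10 p11 -q00; ring.
by ring.
Qed.

Lemma coupled_realization : exists A0 : set (psum H K * psum H K),
  rel_oplus (assoc_symmetric A (scalar_gamma gamma0))
    (assoc_symmetric APhi gammaPhi) `<=` A0 /\
  realizes (hol Q) (scalar_mx1 Q) D A0
    (scalar_gamma (coupled_gamma phi Q0 gamma0 gammaPhi)).
Proof.
have [l0 Dl0] := coupled_dom_nonempty; have Dl0' := coupled_dom_conj Dl0.
have [[[r1 r2] _] _] := Dl0; have [[[r1' r2'] _] _] := Dl0'.
pose cpl := @coupled R H K A APhi gamma0 Q0 g.
have csub := @coupled_sub R H K A APhi sA Phi_selfadjoint D gamma0 Q0 g coupled_dom_conj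
  gamma0_increment (gammaPhi_increment 0) Q0_identity gammaPhi_isotropic.
have sA0 : selfadjoint (cpl l0).
  exact: (coupled_selfadjoint sA Phi_selfadjoint coupled_dom_conj
    gamma0_increment (gammaPhi_increment 0)
    Q0_identity gammaPhi_isotropic Dl0 r1 r2 r1' r2').
exists (cpl l0); split.
  move=> x [[A1 S1] [A2 S2]].
  (* On the sum of the symmetric relations both coefficients vanish, by orthogonality to the
     gamma-fields at the conjugate of l0; there [coupled] reduces to the sum of [A] and [APhi]. *)
  have h0 : coeff1 g l0 x = 0.
    have := S2 _ r2' (e 0); rewrite conjCK; exact.
  have k0 : coeff2 gamma0 Q0 g l0 x = 0.
    rewrite /coeff2 h0 mulr0 addr0.
    have := S1 _ r1' (const_mx 1); rewrite /scalar_gamma mxE scale1r conjCK.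
    exact.
  rewrite /cpl /coupled /= h0 k0 !mulr0 !scale0r !subr0.
  by split; [case: (x) A1|case: (x) A2] => -[? ?] [? ?].
split=> //.
- exists l0; exact: coupled_resolvent_set.
- by move=> l _ a u v; rewrite /scalar_gamma !mxE scalerDl scalerA.
- move=> l k [rl Dl] [_ Dk] h; rewrite /scalar_gamma.
  apply/(resolvent_increment sA0 _ _ _ rl).
  have := coupled_field_increment sA Phi_selfadjoint coupled_dom_conj
    gamma0_increment (gammaPhi_increment 0)
    Q0_identity gammaPhi_isotropic (gammaPhi_increment 1) gammaPhi_off_diagonal Dl Dk.
  (* The increment lies in the relation built at l, which is contained in the one built at l0. *)
  rewrite -!coupled_gammaE// => /(csub _ _ _ Dl Dl0) /(selfadjointZ sA0 (h 0 0)).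
  congr (cpl l0 _); congr (_, _); rewrite [LHS]scalerBr// !scalerA.
  by rewrite [l * _]mulrC [k * _]mulrC.
- move=> l k [rl Dl] [rk Dk] hl hk; apply/matrixP => i j.
  rewrite !ord1 !mxE eqxx !mulr1n coupled_weyl_identity//.
  by rewrite /scalar_gamma !mxE !eqxx !scale1r.
Qed.

End CoupledRealization.

Theorem proposition6p6 (R : realType)
  (r : ratfun R) (kappa kappat : nat) (Q Qt : cplx R -> cplx R)
  (phi phit : ratfun R) (Q0 Q0t : cplx R -> cplx R)
  (H : hilbert R) (A : set (H * H)) (a b : option R)
  (rig : rigging (base A b)) (omega : rg_neg rig) (eta : R)
  (rigt : rigging (base A a)) (omegat : rg_neg rigt) (etat : R)
  (gamma0 gamma0t : cplx R -> H)
  (HPhi : pontryagin R) (ev : HPhi -> cplx R -> 'cV[cplx R]_2)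
  (APhi : set (HPhi * HPhi)) (gammaPhi : cplx R -> 'cV[cplx R]_2 -> HPhi)
  (HPhit : pontryagin R) (evt : HPhit -> cplx R -> 'cV[cplx R]_2)
  (APhit : set (HPhit * HPhit))
  (gammaPhit : cplx R -> 'cV[cplx R]_2 -> HPhit) :
  nonconstant r -> symmetric_on (rdom r) r ->
  gen_nevanlinna_mul kappa kappat r Q -> nonzero Q -> is_rmul r Q Qt ->
  canonical_factorization Q phi Q0 ->
  canonical_factorization Qt phit Q0t ->
  selfadjoint A ->
  model_realizes omega eta gamma0 Q0 ->
  model_realizes omegat etat gamma0t Q0t ->
  rk_space (Phi_dom phi) (mxnevkernel (Phi_mx phi)) ev ->
  realizes (Phi_dom phi) (Phi_mx phi) setT APhi gammaPhi ->
  rk_space (Phi_dom phit) (mxnevkernel (Phi_mx phit)) evt ->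
  realizes (Phi_dom phit) (Phi_mx phit) setT APhit gammaPhit ->
  let S0 := assoc_symmetric A (scalar_gamma gamma0) in
  let S0t := assoc_symmetric A (scalar_gamma gamma0t) in
  let SPhi := assoc_symmetric APhi gammaPhi in
  let SPhit := assoc_symmetric APhit gammaPhit in
  let gamma := coupled_gamma phi Q0 gamma0 gammaPhi in
  let gammat := coupled_gamma phit Q0t gamma0t gammaPhit in
  (exists A0 : set (psum H HPhi * psum H HPhi),
     rel_oplus S0 SPhi `<=` A0 /\
     realizes (hol Q) (scalar_mx1 Q) (coupled_dom phi Q0 A APhi)
       A0 (scalar_gamma gamma)) /\
  (exists A0t : set (psum H HPhit * psum H HPhit),
     rel_oplus S0t SPhit `<=` A0t /\
     realizes (hol Qt) (scalar_mx1 Qt) (coupled_dom phit Q0t A APhit)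
       A0t (scalar_gamma gammat)).
Proof.
move=> _ _ _ _ _ fQ fQt sA mQ mQt rk re rkt ret /=.
by split; [exact: coupled_realization fQ sA mQ rk re|
  exact: coupled_realization fQt sA mQt rkt ret].
Qed.
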